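(* Let $N\ge3$. Then for all toroidal fields $\boldsymbol U$ on $\mathbb R^N$, $$\int_{\mathbb R^N}|\nabla \boldsymbol U|^2dx+\int_{\mathbb R^N}|\boldsymbol U|^2|x|^2dx-(N+2)\int_{\mathbb R^N}|\boldsymbol U|^2dx\ \ge\ 2\inf_{A\in\mathcal A_N}\int_{\mathbb R^N}\big|\boldsymbol U-Axe^{-\frac{|x|^2}{2}}\big|^2dx+2\inf_{\substack{A\in\mathcal A_N\\ \mathcal B\in\mathcal M_N}}\int_{\mathbb R^N}\big|\boldsymbol U-(Ax+\mathcal Bx\cdot x)e^{-\frac{|x|^2}{2}}\big|^2dx .$$ The constant $2$ in the first term on the right-hand side is sharp (it cannot be replaced by a larger constant).
   Context: All fields are real-valued. A vector field $\boldsymbol U:\mathbb R^N\to\mathbb R^N$ is toroidal if $\boldsymbol U(x)\cdot x=0$ for all $x$ and $\operatorname{div}\boldsymbol U=0$. The fields are assumed to be smooth with $\int|\nabla\boldsymbol U|^2+\int|\boldsymbol U|^2|x|^2+\int|\boldsymbol U|^2<\infty$, or to belong to the completion of such fields for the corresponding norm. $\mathcal A_N$ is the set of antisymmetric real $N\times N$ matrices. $\mathcal M_N$ is the set of $N$-tuples $\mathcal B=(B^1,\dots,B^N)$ of symmetric real $N\times N$ matrices such that $$\operatorname{Tr} B^k=0,\qquad \sum_{i=1}^NB^i_{ik}=0,\qquad B^i_{jl}+B^j_{il}+B^l_{ij}=0\qquad\text{for all }i,j,k,l\in\{1,\dots,N\},$$ and $\mathcal Bx\cdot x:=(B^1x\cdot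 x,\dots,B^Nx\cdot x)$. *)

(* Defs.v *)
From HB Require Import structures.
From mathcomp Require Import all_boot all_order all_algebra.
From mathcomp Require Import all_classical all_reals all_analysis.

Set Implicit Arguments.
Unset Strict Implicit.
Unset Printing Implicit Defensive.

Import Order.TTheory GRing.Theory Num.Theory.
Import numFieldNormedType.Exports.

Local Open Scope classical_set_scope.
Local Open Scope ring_scope.

Section LebesgueTuple.
Context {R : realType}.
Local Open Scope ereal_scope.

Definition tuple_cons n (p : measurableTypeR R * n.-tuple (measurableTypeR R)) : n.+1.-tuple (measurableTypeR R) :=
  [tuple of p.1 :: p.2].

Fixpoint lebesgue_tuple n : set (n.-tuple (measurableTypeR R)) -> \bar R :=
  match n with
  | 0 => dirac [tuple]
  | n'.+1 => pushforward (lebesgue_measure \x @lebesgue_tuple n')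
               (@tuple_cons n')
  end.

Lemma measurable_tuple_cons n : measurable_fun setT (@tuple_cons n).
Proof. exact: measurable_cons. Qed.

Section step.
Variables (n : nat) (m : {sigma_finite_measure set (n.-tuple (measurableTypeR R)) -> \bar R}).

Definition lebesgue_tuple_step : set (n.+1.-tuple (measurableTypeR R)) -> \bar R :=
  pushforward (lebesgue_measure \x m) (@tuple_cons n).

Let measurable_preimage (A : set (n.+1.-tuple (measurableTypeR R))) :
  measurable A -> measurable (@tuple_cons n @^-1` A).
Proof.
by move=> mA; rewrite -[X in measurable X]setTI; exact: measurable_tuple_cons.
Qed.

Let step0 : lebesgue_tuple_step set0 = 0.
Proof. by rewrite /lebesgue_tuple_step /pushforward preimage_set0 measure0. Qed.

Let step_ge0 A : 0 <= lebesgue_tuple_step A.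
Proof. by rewrite /lebesgue_tuple_step /pushforward measure_ge0. Qed.

Let step_sigma_additive : semi_sigma_additive lebesgue_tuple_step.
Proof.
move=> F mF tF mUF; rewrite /lebesgue_tuple_step /pushforward preimage_bigcup.
apply: measure_semi_sigma_additive.
- by move=> i; exact: measurable_preimage.
- apply/trivIsetP => /= i j _ _ ij; rewrite -preimage_setI.
  by move/trivIsetP : tF => /(_ _ _ _ _ ij) ->//; rewrite preimage_set0.
- by rewrite -preimage_bigcup; exact: measurable_preimage.
Qed.

HB.instance Definition _ := isMeasure.Build _ _ _
  lebesgue_tuple_step step0 step_ge0 step_sigma_additive.

Let step_sigma_finite : sigma_finite setT lebesgue_tuple_step.
Proof.
have /sigma_finiteP[F [FT ndF Ffin]] := sigma_finiteT (@lebesgue_measure R).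
have /sigma_finiteP[G [GT ndG Gfin]] := sigma_finiteT m.
pose u (t : n.+1.-tuple (measurableTypeR R)) := (thead t, [tuple of behead t]).
have uK p : u (tuple_cons p) = p.
  by case: p => x t; rewrite /u /tuple_cons theadE; congr pair; exact: val_inj.
have mu : measurable_fun setT u.
  apply: measurable_fun_pair; first exact: measurable_tnth.
  exact: measurable_behead.
exists (fun i => u @^-1` (F i `*` G i)).
  apply/esym/seteqP; split=> // t _.
  have [k _ Fk] : (\bigcup_k F k) (thead t) by rewrite -FT.
  have [l _ Gl] : (\bigcup_k G k) [tuple of behead t] by rewrite -GT.
  exists (maxn k l) => //; split => /=.
    by move: Fk; apply/subsetPset/ndF/leq_maxl.
  by move: Gl; apply/subsetPset/ndG/leq_maxr.
move=> i; have [mF Fi] := Ffin i; have [mG Gi] := Gfin i; split.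
  by rewrite -[X in measurable X]setTI; apply: mu => //; exact: measurableX.
rewrite /lebesgue_tuple_step /pushforward.
rewrite -comp_preimage (_ : u \o _ = id) ?preimage_id; last exact/funext/uK.
by rewrite product_measure1E// lte_mul_pinfty// ge0_fin_numE.
Qed.

HB.instance Definition _ := Measure_isSigmaFinite.Build _ _ _
  lebesgue_tuple_step step_sigma_finite.

End step.

Lemma lebesgue_tuple_subproof n :
  exists m : {sigma_finite_measure set (n.-tuple (measurableTypeR R)) -> \bar R},
    m = @lebesgue_tuple n :> (set _ -> \bar R).
Proof.
elim: n => [|n [m mE]].
  by exists [the {sigma_finite_measure set _ -> \bar R} of dirac [tuple]].
exists [the {sigma_finite_measure set _ -> \bar R} of lebesgue_tuple_step m].
by rewrite /= /lebesgue_tuple_step mE.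
Qed.

Section instances.
Variable n : nat.

Let lebesgue_tuple0 : @lebesgue_tuple n set0 = 0.
Proof. by have [m <-] := lebesgue_tuple_subproof n; exact: measure0. Qed.

Let lebesgue_tuple_ge0 A : 0 <= @lebesgue_tuple n A.
Proof. by have [m <-] := lebesgue_tuple_subproof n; exact: measure_ge0. Qed.

Let lebesgue_tuple_sigma_additive : semi_sigma_additive (@lebesgue_tuple n).
Proof.
by have [m <-] := lebesgue_tuple_subproof n; exact: measure_semi_sigma_additive.
Qed.

HB.instance Definition _ := isMeasure.Build _ _ _ (@lebesgue_tuple n)
  lebesgue_tuple0 lebesgue_tuple_ge0 lebesgue_tuple_sigma_additive.

Let lebesgue_tuple_sigma_finite : sigma_finite setT (@lebesgue_tuple n).
Proof. by have [m <-] := lebesgue_tuple_subproof n; exact: sigma_finiteT. Qed.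

HB.instance Definition _ := Measure_isSigmaFinite.Build _ _ _
  (@lebesgue_tuple n) lebesgue_tuple_sigma_finite.

End instances.

End LebesgueTuple.

(* Points of R^N are row vectors 'rV[R]_N. The norm of the library on matrices
   is the sup norm: it is used only for its topology, and the Euclidean
   (Frobenius) norm of vectors and gradients is given by sqnorm. *)
Section Fields.
Context {R : realType}.

Definition sqnorm m n (M : 'M[R]_(m, n)) : R := \sum_i \sum_j M i j ^+ 2.

Section Dimension.
Variable N : nat.
Implicit Types (U : 'rV[R]_N -> 'rV[R]_N) (G : 'rV[R]_N -> 'M[R]_N).

Definition row_of_tuple (t : N.-tuple (measurableTypeR R)) : 'rV[R]_N :=
  \row_i (tnth t i : R).

Definition integralN (f : 'rV[R]_N -> R) : \bar R :=
  (\int[@lebesgue_tuple R N]_t (f (row_of_tuple t))%:E)%E.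

Definition measurableN (f : 'rV[R]_N -> R) : Prop :=
  measurable_fun [set: N.-tuple (measurableTypeR R)] (f \o row_of_tuple).

Definition partial (i : 'I_N) (f : 'rV[R]_N -> R) : 'rV[R]_N -> R :=
  fun x => 'D_(delta_mx 0 i) f x.

Definition smooth (f : 'rV[R]_N -> R) : Prop :=
  forall s : seq 'I_N,
    continuous (foldr partial f s) /\
    forall i x, derivable (foldr partial f s) x (delta_mx 0 i).

Definition grad U : 'rV[R]_N -> 'M[R]_N :=
  fun x => \matrix_(i, j) partial i (fun y => U y 0 j) x.

Definition divergence U : 'rV[R]_N -> R :=
  fun x => \sum_i partial i (fun y => U y 0 i) x.

Definition toroidal U : Prop :=
  (forall x, \sum_i U x 0 i * x 0 i = 0) /\ (forall x, divergence U x = 0).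

(* The squared norm, with G in the role of the gradient of U. *)
Definition energy U G : \bar R :=
  (integralN (fun x => sqnorm (G x))
   + integralN (fun x => (sqnorm (U x) * sqnorm x)%R)
   + integralN (fun x => sqnorm (U x)))%E.

Definition smooth_toroidal U : Prop :=
  [/\ forall j, smooth (fun x => U x 0 j), toroidal U
    & (energy U (grad U) < +oo)%E].

(* The completion is realized concretely: its elements are the limits (U, G),
   in the weighted L^2 spaces, of the pairs (V, grad V) with V smooth, toroidal
   and of finite energy. G is the gradient of U in the completion. *)
Definition toroidal_completion U G : Prop :=
  [/\ forall j, measurableN (fun x => U x 0 j),
      forall i j, measurableN (fun x => G x i j)
    & exists2 V : nat -> 'rV[R]_N -> 'rV[R]_N,
        forall k, smooth_toroidal (V k)
      & energy (fun x => V k x - U x) (fun x => grad (V k) x - G x)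
          @[k --> \oo] --> 0%E].

Definition toroidal_field U G : Prop :=
  (smooth_toroidal U /\ G = grad U) \/ toroidal_completion U G.

Definition antisymmetric_mx : set 'M[R]_N := [set A | A^T = - A].

(* B i j l is the entry (j, l) of the i-th matrix. *)
Definition toroidal_tensors : set ('I_N -> 'M[R]_N) :=
  [set B | [/\ forall k, (B k)^T = B k,
               forall k, \tr (B k) = 0,
               forall k, \sum_i B i i k = 0
             & forall i j l, B i j l + B j i l + B l i j = 0]].

Definition linear_field (A : 'M[R]_N) (x : 'rV[R]_N) : 'rV[R]_N :=
  (A *m x^T)^T.

Definition quadratic_field (B : 'I_N -> 'M[R]_N) (x : 'rV[R]_N) : 'rV[R]_N :=
  \row_k (x *m B k *m x^T) 0 0.

Definition gaussian (x : 'rV[R]_N) : R := expR (- (sqnorm x / 2)).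

Definition dist_linear U : \bar R :=
  ereal_inf [set integralN (fun x => sqnorm (U x -
                   gaussian x *: linear_field A x))
            | A in antisymmetric_mx].

Definition dist_quadratic U : \bar R :=
  ereal_inf [set integralN (fun x => sqnorm (U x -
                   gaussian x *: (linear_field A x + quadratic_field B x)))
            | A in antisymmetric_mx & B in toroidal_tensors].

Definition deficit U G : \bar R :=
  (integralN (fun x => sqnorm (G x))
   + integralN (fun x => (sqnorm (U x) * sqnorm x)%R)
   - (N + 2)%:R%:E * integralN (fun x => sqnorm (U x)))%E.

End Dimension.
End Fields.

(* Main.v *)
Require Import Defs.
From HB Require Import structures.
From mathcomp Require Import all_boot all_order all_algebra.
From mathcomp Require Import all_classical all_reals all_analysis.
From mathcomp Require Import measurable_realfun ring lra.

(* The operator -Lap + |x|^2 has eigenvalues N + 2 k, with eigenspaces spanned by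
   the Hermite functions of degree k. A toroidal field has no component in degree 0,
   its component in degree 1 is A x e^{-|x|^2/2} with A antisymmetric, and its
   component in degree 2 is (B x . x) e^{-|x|^2/2} with B in M_N. So with a_k the
   squared norm of the component of degree k the left-hand side is the sum of
   2 (k - 1) a_k over k >= 2, the two distances are the sums of a_k over k >= 2 and
   over k >= 3, and the inequality holds term by term; for k = 2 it is an equality,
   whence the sharpness.

   Only finitely many Hermite coefficients are ever handled at once: a field and its
   gradient are tested against Hermite functions (an identity that is stable under
   limits, hence valid in the completion), Bessel's inequality is applied to the
   images of the field under the annihilation operators d_i + x_i, and the density of
   the Hermite functions in L^2 gives Parseval's identity. For the density: the set of
   functions that multiply the closed span into itself contains
   (x_i - c) e^{-|x|^2/4}, by expanding the exponential, hence the indicator of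
   {x_i > c}, as a limit of bounded polynomials in that function, hence all
   indicators of measurable sets. *)

Set Implicit Arguments.
Unset Strict Implicit.
Unset Printing Implicit Defensive.

Import Order.TTheory GRing.Theory Num.Theory.
Import numFieldNormedType.Exports.
(* The library has a lemma named [integralN]; this restores the definition. *)
Import Defs.

Local Open Scope classical_set_scope.
Local Open Scope ring_scope.

(** * Lebesgue measure on tuples *)

(** The obstacle is the completion, where only a pair ([U], [G]) of L^2 limits is at hand: there are
    no second derivatives, so -Lap + |x|^2 is never applied. Its quadratic form is read off
    first-order expressions instead. When the squares of d_i u + x_i u are expanded, the cross terms
    follow from the virial identity (the integral of d_i (x_i u^2) is 0), and the integrals of these
    squares add up to those of |grad u|^2 + |x|^2 u^2 - N u^2. The coefficient of d_i u + x_i u at a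
    is twice that of u at a + e_i, so Bessel's inequality produces the sum weighted by the degree.

    Toroidality only serves to identify the components of degree at most 2. Orthogonality to the
    gradients of Hermite functions and to their products with x makes certain sums of lowered and of
    raised moments vanish; these relations yield the conditions on A and B.

    Both infima stand on the smaller side, so the candidates built from the moments suffice and no
    minimisation is solved. For sharpness, N >= 3 provides a rotation in a plane together with a
    third coordinate to multiply it by. *)

Section TupleTranslation.
Context {R : realType}.
Notation mT := (measurableTypeR R).
Local Open Scope ereal_scope.

(** Lebesgue measure is determined by the lengths of half-open intervals, which a translation
    preserves. *)
Lemma lebesgue_measure_shift (a : R) (A : set mT) : measurable A ->
  pushforward lebesgue_measure (+%R a : mT -> mT) A = lebesgue_measure A.
Proof.
have ma : measurable_fun [set: mT] (+%R a : mT -> mT) by exact: measurable_funD.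
pose f : {mfun mT >-> mT} := HB.pack (+%R a : mT -> mT) (isMeasurableFun.Build _ _ _ _ _ ma).
move=> mA; apply/esym.
apply: (@lebesgue_measure_unique R (pushforward lebesgue_measure f)) => //= _ [[b c]] _ <-.
rewrite /pushforward (_ : f @^-1` _ = `]b - a, c - a]%classic)%R.
  by rewrite !lebesgue_measure_itv/= !lte_fin ltrD2r -!EFinB (_ : c - a - (b - a) = c - b)%R
    //; ring.
apply/seteqP; split => x /=; rewrite !in_itv/= => /andP[h1 h2]; lra.
Qed.

Lemma ge0_integral_shift (a : R) (f : mT -> \bar R) :
  measurable_fun setT f -> (forall x, 0 <= f x) ->
  \int[lebesgue_measure]_x f (a + x)%R = \int[lebesgue_measure]_x f x.
Proof.
have ma : measurable_fun [set: mT] (+%R a : mT -> mT) by exact: measurable_funD.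
move=> mf f0.
have := @ge0_integral_pushforward _ _ mT mT R _ ma lebesgue_measure setT f measurableT mf
  (fun x _ => f0 x).
rewrite preimage_setT => <-.
by apply: eq_measure_integral => A mA _; exact: lebesgue_measure_shift.
Qed.

Lemma ge0_integral_tupleS n (f : n.+1.-tuple mT -> \bar R) :
  measurable_fun setT f -> (forall x, 0 <= f x) ->
  \int[@lebesgue_tuple R n.+1]_t f t =
  \int[lebesgue_measure]_x \int[@lebesgue_tuple R n]_t f [tuple of x :: t].
Proof.
move=> mf f0.
have := @ge0_integral_pushforward _ _ _ _ R _ (@measurable_tuple_cons R n)
  (lebesgue_measure \x @lebesgue_tuple R n) setT f measurableT mf (fun x _ => f0 x).
rewrite preimage_setT => h.
have mg : measurable_fun setT (f \o @tuple_cons R n).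
  by apply: measurableT_comp => //; exact: measurable_tuple_cons.
have h2 := @fubini_tonelli1 _ _ _ _ R lebesgue_measure (@lebesgue_tuple R n)
  (f \o @tuple_cons R n) mg (fun x => f0 _).
rewrite -[RHS]h2 -[RHS]h; apply: eq_measure_integral => //.
exact: measurable_tuple_cons.
Qed.

Definition tuple_add n (t u : n.-tuple mT) : n.-tuple mT := [tuple (tnth t i + tnth u i)%R |
  i < n].

Lemma measurable_tuple_add d (T : measurableType d) n (f g : T -> n.-tuple mT) :
  measurable_fun setT f -> measurable_fun setT g ->
  measurable_fun setT (fun x => tuple_add (f x) (g x)).
Proof.
move=> mf mg; apply/measurable_fun_tnthP => i.
rewrite (_ : _ \o _ = (fun x => tnth (f x) i + tnth (g x) i)%R); last first.
  by apply/funext => x /=; rewrite tnth_mktuple.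
have m1 := measurableT_comp (@measurable_tnth _ mT n i) mf.
have m2 := measurableT_comp (@measurable_tnth _ mT n i) mg.
exact: (measurable_funD m1 m2).
Qed.

Lemma tuple_add_cons n x y (t u : n.-tuple mT) :
  tuple_add [tuple of x :: t] [tuple of y :: u] = [tuple of (x + y)%R :: tuple_add t u].
Proof.
apply: eq_from_tnth => i; rewrite tnth_mktuple.
by have [j ->|->] := unliftP ord0 i; rewrite ?tnth0 // !tnthS tnth_mktuple.
Qed.

(** Induction on the dimension through Tonelli's theorem: the induction hypothesis shifts the inner
    integral by the tail of [u], the one-dimensional case shifts the outer one by its head. *)
Lemma ge0_integral_tuple_shift n (u : n.-tuple mT) (f : n.-tuple mT -> \bar R) :
  measurable_fun setT f -> (forall x, 0 <= f x) ->
  \int[@lebesgue_tuple R n]_t f (tuple_add u t) = \int[@lebesgue_tuple R n]_t f t.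
Proof.
elim: n u f => [|n IH] u f mf f0.
  by apply: eq_integral => t _; congr f; rewrite tuple0 [RHS]tuple0.
rewrite ge0_integral_tupleS//; last first.
  apply: measurableT_comp => //; apply: measurable_tuple_add => //.
rewrite [RHS]ge0_integral_tupleS//.
rewrite (tuple_eta u).
set a := thead u; set v := [tuple of behead u].
have mc x : measurable_fun setT (fun t : n.-tuple mT => [tuple of x :: t] : n.+1.-tuple mT).
  exact: measurable_cons.
under eq_integral => x _.
  under eq_integral do rewrite tuple_add_cons.
  rewrite (IH v (fun t => f [tuple of (a + x)%R :: t])) //; last first.
    exact: (measurableT_comp mf).
  over.
rewrite -[RHS](@ge0_integral_shift a) //.
  have mF : measurable_fun setT (f \o (@tuple_cons R n)).
    by apply: measurableT_comp => //; exact: measurable_tuple_cons.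
  have mG := @measurable_fun_fubini_tonelli_F _ _ mT (n.-tuple mT) R (@lebesgue_tuple R n) _
    mF (fun x => f0 _).
  exact: mG.
by move=> x; exact: integral_ge0.
Qed.

End TupleTranslation.

(** * Gaussian integrals and measurability of continuous functions *)

Section GaussianAndMeasurability.
Context {R : realType}.
Notation mT := (measurableTypeR R).

Lemma sqnorm_row N (x : 'rV[R]_N) : sqnorm x = \sum_i x 0 i ^+ 2.
Proof. by rewrite /sqnorm big_ord1. Qed.

Lemma integral_gauss_scaled (c : R) : 0 < c -> exists2 r : R, 0 < r &
  (\int[lebesgue_measure]_(x in [set: mT]) (expR (- (c * x ^+ 2)))%:E = r%:E)%E.
Proof.
(* The standard deviation for which the normal density has exponent [- (c * x ^+ 2)]. *)
move=> c0; pose s := Num.sqrt (2 * c)^-1.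
have s0 : s != 0 by rewrite gt_eqF// sqrtr_gt0 invr_gt0 mulr_gt0.
have s2 : s ^+ 2 = (2 * c)^-1 by rewrite sqr_sqrtr// invr_ge0 mulr_ge0// ltW.
exists (normal_peak s)^-1; first by rewrite invr_gt0 normal_peak_gt0.
have := integral_normal_pdf 0 s.
rewrite normal_pdfE//.
under eq_integral do rewrite EFinM.
rewrite ge0_integralZl//=.
- move=> h.
  rewrite (_ : (\int[_]_(x in _) _)%E = (\int[lebesgue_measure]_x (normal_fun 0 s x)%:E)%E);
    last first.
    apply: eq_integral => x _; rewrite /normal_fun subr0 s2; congr (expR _)%:E.
    by rewrite -mulr_natr; field; rewrite gt_eqF.
  have : (0 <= \int[lebesgue_measure]_x (normal_fun 0 s x)%:E)%E.
    by apply: integral_ge0 => x _; rewrite lee_fin normal_fun_ge0.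
  move: h; case: (\int[_]_x _)%E => [r| |] //=.
    rewrite -EFinM => -[h] _; congr EFin.
    by apply: (mulfI (x := normal_peak s)); rewrite ?h ?mulfV // gt_eqF// normal_peak_gt0.
  by rewrite gt0_muley// lte_fin normal_peak_gt0.
- by apply/measurable_EFinP; exact: measurable_normal_fun.
- by move=> x _; rewrite lee_fin normal_fun_ge0.
- by rewrite lee_fin normal_peak_ge0.
Qed.

Lemma measurable_coord N (i : 'I_N) : measurableN (fun x : 'rV[R]_N => x 0 i).
Proof.
rewrite /measurableN (_ : _ \o _ = (fun t => tnth t i)); first exact: measurable_tnth.
by apply/funext => t /=; rewrite mxE.
Qed.

Lemma measurable_sqnorm N : measurableN (@sqnorm R 1 N).
Proof.
rewrite /measurableN (_ : _ \o _ = (fun t => \sum_i (row_of_tuple t 0 i) ^+ 2)).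
  apply: measurable_sum => i; apply: measurable_funX; exact: measurable_coord.
by apply/funext => t /=; rewrite sqnorm_row.
Qed.

Lemma measurable_expN_sqnorm N (c : R) :
  measurableN (fun x : 'rV[R]_N => expR (- (c * sqnorm x))).
Proof.
apply: measurableT_comp => //; apply: measurableT_comp => //.
by apply: measurable_funM => //; exact: measurable_sqnorm.
Qed.

Lemma integral_expN_sqnorm N (c : R) : 0 < c -> exists2 r : R, 0 < r &
  integralN (fun x : 'rV[R]_N => expR (- (c * sqnorm x))) = r%:E.
Proof.
move=> c0; have [r r0 hr] := integral_gauss_scaled c0.
rewrite /integralN.
elim: N => [|n [q q0 hq]].
  exists 1 => //.
  transitivity (\int[\d_ ([tuple] : 0.-tuple mT)]_t (expR (- (c * sqnorm (row_of_tuple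
    t))))%:E)%E.
    exact: eq_measure_integral.
  rewrite integral_dirac//=; last by apply/measurable_EFinP; exact: measurable_expN_sqnorm.
  rewrite diracE mem_set// mul1e.
  by rewrite sqnorm_row big_ord0 mulr0 oppr0 expR0.
exists (r * q); first exact: mulr_gt0.
rewrite ge0_integral_tupleS//=; last first.
  apply/measurable_EFinP; exact: measurable_expN_sqnorm.
transitivity (\int[lebesgue_measure]_(x in [set: mT]) ((expR (- (c * x ^+ 2)))%:E * q%:E))%E.
  apply: eq_integral => x _; rewrite -hq -ge0_integralZl//=.
  - apply: eq_integral => t _; rewrite -EFinM -expRD; congr (expR _)%:E.
    rewrite !sqnorm_row big_ord_recl !mxE tnth0 -opprD -mulrDr.
    by do 3 congr (_ _); apply: eq_bigr => i _; rewrite !mxE tnthS.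
  - apply/measurable_EFinP; exact: measurable_expN_sqnorm.
rewrite ge0_integralZr//= ?hr ?EFinM//.
apply/measurable_EFinP; apply: measurableT_comp => //.
by apply: measurableT_comp => //; apply: measurable_funM => //; exact: measurable_funX.
by rewrite lee_fin ltW.
Qed.

(** The topology of row vectors and the product sigma-algebra of tuples are tied together by the
    countable family of cubes with rational centre and half-side 1/(k+1): an open set is the union
    of those it contains. *)
Lemma open_measurableN N (O : set 'rV[R]_N) : open O ->
  measurable (@row_of_tuple R N @^-1` O).
Proof.
move=> oO.
pose B (p : {ffun 'I_N -> rat} * nat) : set (N.-tuple mT) :=
  [set t | forall i, ball (ratr (p.1 i) : R) (p.2.+1%:R^-1) (tnth t i)].
pose C p := [set t | B p t /\ B p `<=` @row_of_tuple R N @^-1` O].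
have -> : @row_of_tuple R N @^-1` O = \bigcup_p C p.
  apply/seteqP; split => [t /= Ot|t [p _ [Bt +]]]; last exact.
  have /nbhs_ballP[e /= e0 he] := open_nbhs_nbhs (conj oO Ot).
  have [k hk] : exists k : nat, k.+1%:R^-1 < e / 2.
    by have /ltr_add_invr[k] := divr_gt0 e0 (@ltr0n R 2); rewrite add0r; exists k.
  have k0 : 0 < (k.+1%:R^-1 : R) by rewrite invr_gt0.
  have hq i : exists q : rat, ball (ratr q : R) k.+1%:R^-1 (tnth t i).
    have /rat_in_itvoo[q] : (tnth t i : R) < tnth t i + k.+1%:R^-1 by rewrite ltrDl.
    rewrite in_itv/= => /andP[h1 h2].
    by exists q; rewrite /ball /= ltr_norml; rewrite ltrBlDl h2 andbT (@lt_trans _ _ 0)//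
      ?oppr_lt0// subr_gt0.
  have [q hq'] := choice hq.
  exists ([ffun i => q i], k) => //; split => [i|u Bu].
    by rewrite /= ffunE.
  apply: he; split => // a i; rewrite !mxE.
  apply: (@ball_splitr R R (ratr (q i)) (tnth t i) (tnth u i) e).
    by apply: le_ball (hq' i); exact: ltW.
  by apply: le_ball (ltW hk) _ _; have := Bu i; rewrite /= ffunE.
apply: countable_bigcupT_measurable => // p.
have mB : measurable (B p).
  rewrite (_ : B p = \bigcap_(i in [set: 'I_N]) ((fun t : N.-tuple mT => tnth t i) @^-1`
    ball (ratr (p.1 i) : R) (p.2.+1%:R^-1))).
    apply: fin_bigcap_measurable => // i _.
    rewrite -[X in measurable X]setTI; apply: (@measurable_tnth _ mT N i) => //.
    exact: measurable_ball.
  by apply/seteqP; split => [t h i _|t h i]; exact: h.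
have [hp|hp] := pselect (B p `<=` @row_of_tuple R N @^-1` O).
  by rewrite (_ : C p = B p) //; apply/seteqP; split => t // [].
by rewrite (_ : C p = set0) //; apply/seteqP; split => t // [].
Qed.

Lemma continuous_measurableN N (f : 'rV[R]_N -> R) : continuous f -> measurableN f.
Proof.
move=> cf; rewrite /measurableN.
apply: (measurability _ (RGenOpens.measurableE R)) => // _ [_ [a [b ->]] <-].
rewrite setTI comp_preimage; apply: open_measurableN.
by apply: open_comp => [x _|]; [exact: cf|exact: interval_open].
Qed.

End GaussianAndMeasurability.

(** * Square-integrable functions and integration by parts *)

Section L2Space.
Context {R : realType} {N : nat}.
Notation F := ('rV[R]_N -> R).
Implicit Types f g h : F.
Notation mu := (@lebesgue_tuple R N).
Notation row := (@row_of_tuple R N).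

Definition integrableN f := mu.-integrable setT (EFin \o (f \o row)).

Definition L2 f := measurableN f /\ (integralN (fun x => f x ^+ 2)%R < +oo)%E.

(** [fine] sends infinite integrals to 0, so this is the L^2 pairing only between [L2] functions.
    These are genuine functions, not classes, so the pairing is only semidefinite. *)
Definition ip f g : R := fine (integralN (fun x => f x * g x)).

Lemma le_integrableN f g : measurableN f -> integrableN g ->
  (forall x, `|f x| <= g x) -> integrableN f.
Proof.
move=> mf ig fg; apply: (le_integrable measurableT) ig; first exact/measurable_EFinP.
by move=> t _ /=; rewrite lee_fin (le_trans (fg _))// ler_norm.
Qed.

Lemma ge0_integrableN f : measurableN f -> (forall x, 0 <= f x) ->
  (integralN f < +oo)%E -> integrableN f.
Proof.
move=> mf f0 fi; apply/integrableP; split; first exact/measurable_EFinP.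
rewrite (eq_integral (EFin \o (f \o row)))// => t _ /=; rewrite ger0_norm//; exact: f0.
Qed.

Lemma integrableND f g : integrableN f -> integrableN g -> integrableN (fun x => f x + g x).
Proof. by move=> hf hg; apply: eq_integrable (integrableD measurableT hf hg). Qed.

Lemma integrableNZ (c : R) f : integrableN f -> integrableN (fun x => c * f x).
Proof. by move=> hf; apply: eq_integrable (integrableZl measurableT c hf). Qed.

Lemma L2_sqr f : L2 f -> integrableN (fun x => f x ^+ 2).
Proof.
move=> [mf fi]; apply: ge0_integrableN => //; last by move=> x; exact: sqr_ge0.
exact: measurable_funX.
Qed.

Lemma integrableN_L2 f : measurableN f -> integrableN (fun x => f x ^+ 2) -> L2 f.
Proof.
move=> mf /integrableP[_ fi]; split => //; apply: le_lt_trans fi.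
rewrite le_eqVlt; apply/orP; left; apply/eqP; apply: eq_integral => t _ /=.
by rewrite ger0_norm// sqr_ge0.
Qed.

Lemma L2M f g : L2 f -> L2 g -> integrableN (fun x => f x * g x).
Proof.
move=> lf lg; apply: (le_integrableN (g := fun x => f x ^+ 2 + g x ^+ 2)).
- by apply: measurable_funM; [exact: lf.1|exact: lg.1].
- exact: integrableND (L2_sqr lf) (L2_sqr lg).
move=> x; rewrite ler_norml; have := sqr_ge0 (f x + g x); have := sqr_ge0 (f x - g x).
rewrite sqrrB sqrrD => h1 h2; have := sqr_ge0 (f x); have := sqr_ge0 (g x).
by move=> h3 h4; apply/andP; split; lra.
Qed.

Lemma L2D f g : L2 f -> L2 g -> L2 (fun x => f x + g x).
Proof.
move=> lf lg; apply: integrableN_L2; first by apply: measurable_funD; [exact: lf.1|exact: lg.1].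
apply: (le_integrableN (g := fun x => 2 * (f x ^+ 2 + g x ^+ 2))).
- by apply: measurable_funX; apply: measurable_funD; [exact: lf.1|exact: lg.1].
- by apply: integrableNZ; exact: integrableND (L2_sqr lf) (L2_sqr lg).
move=> x; rewrite ger0_norm ?sqr_ge0//; have := sqr_ge0 (f x - g x).
by rewrite sqrrB sqrrD => h; lra.
Qed.

Lemma L2Z (c : R) f : L2 f -> L2 (fun x => c * f x).
Proof.
move=> lf; apply: integrableN_L2; first by apply: measurable_funM => //; exact: lf.1.
have := integrableNZ (c ^+ 2) (L2_sqr lf); congr (integrableN _).
by apply/funext => x; rewrite exprMn.
Qed.

Lemma L2N f : L2 f -> L2 (fun x => - f x).
Proof. by move=> /(L2Z (-1)); congr L2; apply/funext => x; rewrite mulN1r. Qed.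

Lemma L2B f g : L2 f -> L2 g -> L2 (fun x => f x - g x).
Proof. by move=> lf /L2N; exact: L2D. Qed.

Lemma L2_0 : L2 (fun=> 0).
Proof.
split; first exact: measurable_cst.
rewrite /integralN (eq_integral (cst 0%E)) ?integral0 ?ltry// => t _.
by rewrite expr0n.
Qed.

Lemma L2_sum I (s : seq I) (f : I -> F) : (forall i, L2 (f i)) ->
  L2 (fun x => \sum_(i <- s) f i x).
Proof.
move=> lf; elim: s => [|i s IH].
  by have := L2_0; congr L2; apply/funext => x; rewrite big_nil.
have := L2D (lf i) IH; congr L2; apply/funext => x; by rewrite big_cons.
Qed.

Lemma le_L2 f g : measurableN f -> L2 g -> (forall x, `|f x| <= `|g x|) -> L2 f.
Proof.
move=> mf lg fg; apply: integrableN_L2 => //.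
apply: (le_integrableN (g := fun x => g x ^+ 2)).
- exact: measurable_funX.
- exact: L2_sqr.
by move=> x; rewrite ger0_norm ?sqr_ge0// -[f x ^+ 2]real_normK ?num_real// -[g x ^+
  2]real_normK ?num_real// lerXn2r// ?nnegrE.
Qed.

Lemma integralN_fin f : integrableN f -> integralN f = (fine (integralN f))%:E.
Proof. by move=> fi; rewrite fineK//; exact: integrable_fin_num. Qed.

Lemma ipE f g : L2 f -> L2 g -> integralN (fun x => f x * g x) = (ip f g)%:E.
Proof. by move=> lf lg; apply: integralN_fin; exact: L2M. Qed.

Lemma integralN_sqr f : L2 f -> integralN (fun x => f x ^+ 2) = (ip f f)%:E.
Proof. by move=> lf; rewrite -ipE. Qed.

Lemma integralND f g : integrableN f -> integrableN g ->
  integralN (fun x => f x + g x) = (integralN f + integralN g)%E.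
Proof. by move=> fi gi; rewrite /integralN -integralD. Qed.

Lemma integralNZ (c : R) f : integrableN f ->
  integralN (fun x => c * f x) = (c%:E * integralN f)%E.
Proof. by move=> fi; rewrite /integralN -integralZl. Qed.

Lemma ipC f g : ip f g = ip g f.
Proof. by congr (fine (integralN _)); apply/funext => x; rewrite mulrC. Qed.

Lemma ipDl f g h : L2 f -> L2 g -> L2 h -> ip (fun x => f x + g x) h = ip f h + ip g h.
Proof.
move=> lf lg lh; apply: EFin_inj; rewrite EFinD -!ipE//; last exact: L2D.
rewrite -integralND; [|exact: L2M..].
by congr integralN; apply/funext => x; rewrite mulrDl.
Qed.

Lemma ipZl (c : R) f g : L2 f -> L2 g -> ip (fun x => c * f x) g = c * ip f g.
Proof.
move=> lf lg; apply: EFin_inj; rewrite EFinM -!ipE//; last exact: L2Z.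
rewrite -integralNZ; [|exact: L2M].
by congr integralN; apply/funext => x; rewrite mulrA.
Qed.

Lemma ipNl f g : L2 f -> L2 g -> ip (fun x => - f x) g = - ip f g.
Proof.
move=> lf lg; rewrite -[RHS]mulN1r -ipZl//; congr ip.
by apply/funext => x; rewrite mulN1r.
Qed.

Lemma ipBl f g h : L2 f -> L2 g -> L2 h -> ip (fun x => f x - g x) h = ip f h - ip g h.
Proof. by move=> lf lg lh; rewrite ipDl ?ipNl//; exact: L2N. Qed.

Lemma ip0l h : ip (fun=> 0) h = 0.
Proof.
rewrite /ip /integralN (eq_integral (cst 0%E)) ?integral0// => t _.
by rewrite mul0r.
Qed.

Lemma ip_suml I (s : seq I) (f : I -> F) h : (forall i, L2 (f i)) -> L2 h ->
  ip (fun x => \sum_(i <- s) f i x) h = \sum_(i <- s) ip (f i) h.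
Proof.
move=> lf lh; elim: s => [|i s IH].
  rewrite big_nil -[RHS](ip0l h); congr ip; apply/funext => x; by rewrite big_nil.
rewrite big_cons -IH -ipDl//; last exact: L2_sum.
by congr ip; apply/funext => x; rewrite big_cons.
Qed.

Lemma ipDr f g h : L2 f -> L2 g -> L2 h -> ip h (fun x => f x + g x) = ip h f + ip h g.
Proof. by move=> *; rewrite ipC ipDl// ![ip h _]ipC. Qed.

Lemma ipZr (c : R) f g : L2 f -> L2 g -> ip g (fun x => c * f x) = c * ip g f.
Proof. by move=> *; rewrite ipC ipZl// ipC. Qed.

Lemma ipBr f g h : L2 f -> L2 g -> L2 h -> ip h (fun x => f x - g x) = ip h f - ip h g.
Proof. by move=> *; rewrite ipC ipBl// ![ip h _]ipC. Qed.

Lemma ip_sumr I (s : seq I) (f : I -> F) h : (forall i, L2 (f i)) -> L2 h ->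
  ip h (fun x => \sum_(i <- s) f i x) = \sum_(i <- s) ip h (f i).
Proof. by move=> *; rewrite ipC ip_suml//; apply: eq_bigr => i _; rewrite ipC. Qed.

Lemma ip_ge0 f : 0 <= ip f f.
Proof. by apply: fine_ge0; apply: integral_ge0 => t _; rewrite lee_fin -expr2 sqr_ge0. Qed.

Lemma ip_sqrD f g : L2 f -> L2 g ->
  ip (fun x => f x + g x) (fun x => f x + g x) = ip f f + 2 * ip f g + ip g g.
Proof.
move=> lf lg; have lfg := L2D lf lg.
by rewrite ipDl// !ipDr// (ipC g f); ring.
Qed.

Lemma ip_sqrB f g : L2 f -> L2 g ->
  ip (fun x => f x - g x) (fun x => f x - g x) = ip f f - 2 * ip f g + ip g g.
Proof.
move=> lf lg; have lfg := L2B lf lg.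
by rewrite ipBl// !ipBr// (ipC g f); ring.
Qed.

(** The squared norm of f - t g is nonnegative for every t, and the minimising t gives the
    inequality. The case [ip g g = 0] is separate: the expression is then affine in t. *)
Lemma ip_cauchy_schwarz f g : L2 f -> L2 g -> ip f g ^+ 2 <= ip f f * ip g g.
Proof.
move=> lf lg.
have h (t : R) : 0 <= ip f f - 2 * (t * ip f g) + t ^+ 2 * ip g g.
  have := ip_ge0 (fun x => f x - t * g x).
  have ltg := L2Z t lg.
  by rewrite ip_sqrB// ipZr// ipZl// ipZr// expr2 -!mulrA.
have := ip_ge0 g; rewrite le_eqVlt => /orP[/eqP g0|g0].
  rewrite -g0 mulr0.
  have [->|fg0] := eqVneq (ip f g) 0; first by rewrite expr0n.
  (* For this t the affine expression equals [- ip f f - 2], which is negative. *)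
  have := h ((ip f f + 1) / ip f g); rewrite -g0 mulr0 divfK//.
  by have := ip_ge0 f => *; lra.
have := h (ip f g / ip g g).
rewrite expr_div_n -mulrA expr2 mulrA.
move=> h1; rewrite -ler_pdivrMr// -subr_ge0; apply: le_trans h1 _.
by rewrite le_eqVlt; apply/orP; left; apply/eqP; field; rewrite gt_eqF.
Qed.

Lemma ip_le_sqrt f g : L2 f -> L2 g -> `|ip f g| <= Num.sqrt (ip f f) * Num.sqrt (ip g g).
Proof.
move=> lf lg; rewrite -sqrtrM ?ip_ge0// -sqrtr_sqr ler_sqrt ?ip_cauchy_schwarz//.
by rewrite mulr_ge0// ip_ge0.
Qed.

(** Both arguments vary, because the virial identity pairs the gradient of a field with the field
    itself. Expanding around the limits leaves three error terms, each controlled by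
    Cauchy-Schwarz. *)
Lemma cvg_ip (u v : nat -> F) f g : (forall k, L2 (u k)) -> (forall k, L2 (v k)) ->
  L2 f -> L2 g ->
  ip (fun x => u k x - f x) (fun x => u k x - f x) @[k --> \oo] --> 0 ->
  ip (fun x => v k x - g x) (fun x => v k x - g x) @[k --> \oo] --> 0 ->
  ip (u k) (v k) @[k --> \oo] --> ip f g.
Proof.
move=> lu lv lf lg uf vg.
have lu' k := L2B (lu k) lf; have lv' k := L2B (lv k) lg.
have s0 (w : nat -> R) : w @ \oo --> 0 -> Num.sqrt (w k) @[k --> \oo] --> 0.
  by move=> w0; rewrite -[in X in _ --> X](sqrtr0 R); apply: continuous_cvg => //;
    exact: sqrt_continuous.
have n0 (a b : nat -> F) : (forall k, L2 (a k)) -> (forall k, L2 (b k)) ->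
  Num.sqrt (ip (a k) (a k)) * Num.sqrt (ip (b k) (b k)) @[k --> \oo] --> 0 ->
  ip (a k) (b k) @[k --> \oo] --> 0.
  move=> la lb ab0; apply/norm_cvg0P.
  apply: (squeeze_cvgr (f := fun=> 0) _ (@cvg_cst _ 0 _ _ _) ab0).
  by near=> k; rewrite normr_ge0 ip_le_sqrt.
have uf' := s0 _ uf; have vg' := s0 _ vg.
have E k : ip (u k) (v k) = ip f g + (ip (fun x => u k x - f x) (fun x => v k x - g x)
    + ip f (fun x => v k x - g x) + ip (fun x => u k x - f x) g).
  by rewrite !ipBl// !ipBr//; ring.
rewrite (funext E).
rewrite -[in X in _ --> X](addr0 (ip f g)); apply: cvgD; first exact: cvg_cst.
rewrite -[in X in _ --> X](addr0 0); apply: cvgD.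
  rewrite -[in X in _ --> X](addr0 0); apply: cvgD.
    apply: n0 => //; rewrite -[in X in _ --> X](mulr0 0); exact: cvgM.
  apply: (n0 (fun=> f)) => //; rewrite -[in X in _ --> X](mulr0 (Num.sqrt (ip f f))).
  by apply: cvgM => //; exact: cvg_cst.
apply: (n0 _ (fun=> g)) => //; rewrite -[in X in _ --> X](mul0r (Num.sqrt (ip g g))).
by apply: cvgM => //; exact: cvg_cst.
Unshelve. all: by end_near.
Qed.

Section Bessel.
Variables (I : eqType) (e : I -> F) (n : I -> R) (s : seq I).
Hypotheses (le : forall i, L2 (e i)) (n0 : forall i, 0 < n i) (us : uniq s).
Hypothesis eo : forall i j, ip (e i) (e j) = (i == j)%:R * n i.

(** Completing the square in each coefficient. The optimal coefficients give Bessel's inequality;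
    discarding the last sum gives best approximation. The family is orthogonal but not normalised,
    which keeps square roots out. *)
Lemma ip_sqr_expansion f (a : I -> R) : L2 f ->
  ip (fun x => f x - \sum_(i <- s) a i * e i x) (fun x => f x - \sum_(i <- s) a i * e i x) =
  ip f f - \sum_(i <- s) ip f (e i) ^+ 2 / n i
  + \sum_(i <- s) n i * (a i - ip f (e i) / n i) ^+ 2.
Proof.
move=> lf; have lae i : L2 (fun x => a i * e i x) by exact: L2Z.
rewrite ip_sqrB//; last exact: L2_sum.
rewrite ip_sumr// ip_suml//; last exact: L2_sum.
have h i : i \in s -> ip (fun x => a i * e i x) (fun x => \sum_(i <- s) a i * e i x) = a i
  ^+ 2 * n i.
  move=> si; rewrite ip_sumr// (bigD1_seq i)//= big1.
    by rewrite ipZl// ipZr// eo eqxx /=; ring.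
  by move=> j ji; rewrite ipZl// ipZr// eo eq_sym (negbTE ji) /=; ring.
rewrite [X in _ + X]big_seq [X in _ + X](eq_bigr (fun i => a i ^+ 2 * n i)) -?big_seq//.
rewrite -!addrA; congr (_ + _); rewrite mulr_sumr -!sumrN -!big_split /=.
by apply: eq_bigr => i _; rewrite ipZr//; field; rewrite gt_eqF.
Qed.

Lemma bessel f : L2 f -> \sum_(i <- s) ip f (e i) ^+ 2 / n i <= ip f f.
Proof.
move=> lf; have := ip_sqr_expansion (fun i => ip f (e i) / n i) lf.
rewrite [X in _ = _ + X]big1 ?addr0 => [h|i _]; last by rewrite subrr expr0n mulr0.
by rewrite -subr_ge0 -h ip_ge0.
Qed.

Lemma best_approximation f (a : I -> R) : L2 f ->
  ip f f - \sum_(i <- s) ip f (e i) ^+ 2 / n i <=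
  ip (fun x => f x - \sum_(i <- s) a i * e i x) (fun x => f x - \sum_(i <- s) a i * e i x).
Proof.
move=> lf; rewrite ip_sqr_expansion// lerDl sumr_ge0// => i _.
by rewrite mulr_ge0 ?sqr_ge0// ltW.
Qed.

End Bessel.
End L2Space.

(** * Translation invariance and integrals of partial derivatives *)

Section Translation.
Context {R : realType} {N : nat}.
Notation mT := (measurableTypeR R).
Notation F := ('rV[R]_N -> R).
Implicit Types f g h : F.
Notation mu := (@lebesgue_tuple R N).
Notation row := (@row_of_tuple R N).

Lemma row_tuple_add (t u : N.-tuple mT) : row (tuple_add t u) = row t + row u.
Proof. by apply/rowP => i; rewrite !mxE tnth_mktuple. Qed.

Lemma row_of_tupleK (v : 'rV[R]_N) : row [tuple (v 0 i : mT) | i < N] = v.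
Proof. by apply/rowP => i; rewrite mxE tnth_mktuple. Qed.

Lemma measurable_shiftN f (v : 'rV[R]_N) : measurableN f -> measurableN (fun x => f (v + x)).
Proof.
move=> mf; set u : N.-tuple mT := [tuple (v 0 i : mT) | i < N].
have mu_ : measurable_fun setT (fun t : N.-tuple mT => tuple_add u t).
  by apply: measurable_tuple_add.
have := measurableT_comp mf mu_; congr (measurable_fun _ _).
by apply/funext => t /=; rewrite row_tuple_add row_of_tupleK.
Qed.

Lemma integralN_shift f (v : 'rV[R]_N) : measurableN f ->
  integralN (fun x => f (v + x)) = integralN f.
Proof.
move=> mf; set u : N.-tuple mT := [tuple (v 0 i : mT) | i < N].
have mef : measurable_fun setT (EFin \o (f \o row)) by exact/measurable_EFinP.
rewrite /integralN integralE [RHS]integralE; congr (_ - _)%E.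
  rewrite -(ge0_integral_tuple_shift u (f := (EFin \o (f \o row))^\+%E))//;
    last exact: measurable_funepos.
  apply: eq_integral => t _; rewrite !funeposE /= row_tuple_add row_of_tupleK //.
rewrite -(ge0_integral_tuple_shift u (f := (EFin \o (f \o row))^\-%E))//;
  last exact: measurable_funeneg.
apply: eq_integral => t _; rewrite !funenegE /= row_tuple_add row_of_tupleK //.
Qed.

Lemma integrableN_shift f (v : 'rV[R]_N) : integrableN f -> integrableN (fun x => f (v + x)).
Proof.
move=> /integrableP[/measurable_EFinP mf fi]; apply/integrableP; split.
  by apply/measurable_EFinP; exact: measurable_shiftN.
apply: le_lt_trans fi; rewrite le_eqVlt; apply/orP; left; apply/eqP.
have mg : measurableN (fun x => `|f x|) by exact: measurableT_comp.
exact: (integralN_shift v mg).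
Qed.

Lemma line_derivable f (x v : 'rV[R]_N) (s : R) :
  derivable f (x + s *: v) v -> derivable (fun s : R => f (x + s *: v)) s 1.
Proof.
have E : (fun h : R => h^-1 *: (((fun s => f (x + s *: v)) \o shift s) (h *: (1 : R)) - f (x
  + s *: v)))
    = (fun h : R => h^-1 *: ((f \o shift (x + s *: v)) (h *: v) - f (x + s *: v))).
  apply/funext => h /=; congr (_ *: (f _ - _)).
  by rewrite [h *: 1]mulr1 scalerDl addrCA.
by rewrite /derivable E.
Qed.

Lemma line_derive f (x v : 'rV[R]_N) (s : R) :
  'D_1 (fun s : R => f (x + s *: v)) s = 'D_v f (x + s *: v).
Proof.
have E : (fun h : R => h^-1 *: (((fun s => f (x + s *: v)) \o shift s) (h *: (1 : R)) - f (x
  + s *: v)))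
    = (fun h : R => h^-1 *: ((f \o shift (x + s *: v)) (h *: v) - f (x + s *: v))).
  apply/funext => h /=; congr (_ *: (f _ - _)).
  by rewrite [h *: 1]mulr1 scalerDl addrCA.
by rewrite /derive E.
Qed.

Lemma line_continuous f (x v : 'rV[R]_N) : continuous f ->
  continuous (fun s : R => f (x + s *: v)).
Proof.
move=> cf s; apply: (@continuous_comp _ _ _ (fun s : R => x + s *: v) f); last exact: cf.
apply: cvgD; first exact: cvg_cst.
by apply: cvgZ; [exact: cvg_id|exact: cvg_cst].
Qed.

Lemma line_FTC f (i : 'I_N) (x : 'rV[R]_N) : continuous f ->
  (forall x, derivable f x (delta_mx 0 i)) -> continuous (partial i f) ->
  (\int[lebesgue_measure]_(s in `[0%R, 1%R]) (partial i f (x + s *: delta_mx 0 i))%:E =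
   (f (x + delta_mx 0 i) - f x)%:E)%E.
Proof.
move=> cf df cdf.
rewrite (@continuous_FTC2 R _ (fun s => f (x + s *: delta_mx 0 i)))//.
- by rewrite scale1r scale0r addr0 EFinB.
- by apply: continuous_subspaceT => s; exact: line_continuous.
- have cl := line_continuous (x := x) (v := delta_mx 0 i) cf; split.
  + by move=> s _; apply: line_derivable; exact: df.
  + by apply: cvg_at_right_filter; exact: cl.
  + by apply: cvg_at_left_filter; exact: cl.
- by move=> s _; rewrite derive1E line_derive.
Qed.

(* Integrate f (x + e_i) - f x, the integral over s in [0, 1] of the derivative at
   x + s e_i, with respect to x: both sides are translation invariant. *)
Lemma integralN_partial f (i : 'I_N) : continuous f ->
  (forall x, derivable f x (delta_mx 0 i)) -> continuous (partial i f) ->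
  integrableN f -> integrableN (partial i f) -> integralN (partial i f) = 0%E.
Proof.
move=> cf df cdf fi dfi; set g := partial i f in cdf dfi *.
(* This local [hermfun] is the map (s, t) |-> t + s e_i, not a Hermite function. *)
pose hermfun (p : mT * N.-tuple mT) : N.-tuple mT :=
  tuple_add p.2 [tuple ((p.1 : R) * (j == i)%:R : mT) | j < N].
have mhermfun : measurable_fun setT hermfun.
  apply: measurable_tuple_add => //; apply/measurable_fun_tnthP => j.
  rewrite (_ : _ \o _ = fun p : mT * N.-tuple mT => (p.1 : R) * (j == i)%:R).
    exact: measurable_funM.
  by apply/funext => p /=; rewrite tnth_mktuple.
have rhermfun s t : row (hermfun (s, t)) = row t + s *: delta_mx 0 i.
  rewrite row_tuple_add; congr (_ + _); apply/rowP => j.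
  by rewrite !mxE tnth_mktuple eqxx.
pose ind (s : R) : R := \1_(`[0, 1]%classic) s.
pose H (p : mT * N.-tuple mT) : \bar R := (ind p.1 * g (row (hermfun p)))%:E.
have mg : measurableN g by exact: continuous_measurableN.
have mind : measurable_fun [set: mT] ind by exact: measurable_indic.
have mH : measurable_fun setT H.
  apply/measurable_EFinP; apply: measurable_funM.
    exact: (measurableT_comp mind).
  exact: (measurableT_comp mg).
have shE h : measurableN h -> forall s, (\int[mu]_t (h (row (hermfun (s,
  t))))%:E = integralN h)%E.
  move=> mh s; rewrite -(integralN_shift (s *: delta_mx 0 i) mh).
  by apply: eq_integral => t _; rewrite rhermfun addrC.
have ind0 s : 0 <= ind s by rewrite /ind indicE ler0n.
have intind : (\int[lebesgue_measure]_(s in [set: mT]) (ind s)%:E = 1)%E.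
  by rewrite integral_indic//= setIT lebesgue_measure_itv/= lte_fin ltr01 oppr0 adde0.
have iind : lebesgue_measure.-integrable [set: mT] (EFin \o ind).
  apply/integrableP; split; first exact/measurable_EFinP.
  under eq_integral do rewrite /= ger0_norm ?ind0//.
  by rewrite intind ltry.
have iH : (lebesgue_measure \x mu)%E.-integrable setT H.
  apply/integrable12ltyP => //.
  rewrite (eq_integral (fun s : mT => integralN (fun x => `|g x|%R) * (ind s)%:E)%E).
    have ng : integrableN (fun x => `|g x|) by exact: (integrable_norm dfi).
    by rewrite (integralN_fin ng) integralZl// intind mule1 ltry.
  move=> s _; rewrite -(shE (fun x => `|g x|) _ s); last exact: measurableT_comp.
  rewrite -ge0_integralZr//=; last 2 first.
  - apply/measurable_EFinP; apply: measurableT_comp => //.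
    by apply: (measurableT_comp mg); exact: (measurableT_comp mhermfun).
  - by rewrite lee_fin ind0.
  by apply: eq_integral => t _; rewrite normrM mulrC EFinM [`|ind s|]ger0_norm ?ind0.
(* Integrating over x first gives the integral of [g], whatever s; integrating over s first gives f
   (x + e_i) - f x, whose integral vanishes by translation invariance. *)
have := Fubini iH.
have -> : (\int[lebesgue_measure]_x \int[mu]_y H (x, y) = integralN g)%E.
  rewrite (eq_integral (fun s : mT => integralN g * (ind s)%:E)%E).
    by rewrite (integralN_fin dfi) integralZl// intind mule1.
  move=> s _; rewrite -(shE g mg s) -integralZr//.
    by apply: eq_integral => t _; rewrite /H EFinM muleC.
  have := integrableN_shift (s *: delta_mx 0 i) dfi; apply: eq_integrable => //.
  by move=> t _ /=; rewrite rhermfun addrC.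
move=> ->.
rewrite (eq_integral (fun t => (f (delta_mx 0 i + row t) - f (row t))%:E)).
  have := integralND (integrableN_shift (delta_mx 0 i) fi) (integrableNZ (-1) fi).
  have mf : measurableN f by exact: continuous_measurableN.
  rewrite integralNZ// integralN_shift// mulN1e subee//; last exact: integrable_fin_num.
  by move=> <-; apply: eq_integral => t _; rewrite mulN1r.
move=> t _; rewrite [X in f X]addrC -line_FTC// [RHS]integral_mkcond.
apply: eq_integral => s _; rewrite /H /ind /= patchE indicE rhermfun.
by case: ifPn => _; rewrite ?mul1r ?mul0r.
Qed.

End Translation.

(** * Hermite functions *)

Section HermitePolynomials.
Context {R : realType}.

(** The monic Hermite polynomials for the weight e^{-x^2}, that is 2^{-n} times the physicists'
    ones. *)
Fixpoint hermite n : {poly R} :=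
  if n is m.+1 then 'X * hermite m - 2^-1 *: (hermite m)^`() else 1.

Lemma deriv_hermite n : (hermite n)^`() = n%:R *: hermite n.-1.
Proof.
elim: n => [|n IH] /=; first by rewrite derivC scale0r.
rewrite derivB derivM derivX mul1r derivZ IH derivZ.
case: n IH => [|n] IH; first by rewrite !scale0r mulr0 scaler0 subr0 addr0 scale1r.
rewrite -[n.+2%:R]natr1 scalerDl scale1r [RHS]addrC -addrA; congr (_ + _).
by rewrite /= scalerBr scalerAr; congr (_ - _); rewrite !scalerA mulrC.
Qed.

Lemma hermite_mulX n : 'X * hermite n = hermite n.+1 + (n%:R / 2) *: hermite n.-1.
Proof. by rewrite /= deriv_hermite scalerA mulrC [_^-1 * _]mulrC subrK. Qed.

End HermitePolynomials.

Section HermiteFunctions.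
Context {R : realType} {N : nat}.
Notation F := ('rV[R]_N -> R).
Notation idx := {ffun 'I_N -> nat}.
Implicit Types (f g : F) (x : 'rV[R]_N) (a b : idx) (i j : 'I_N).

Definition inc a i : idx := [ffun k => (a k + (k == i))%N].
(** Truncated subtraction: [dec a i] is [a] when [a i] is 0, but it is then multiplied by
    [(a i)%:R], which is 0, or filtered out. *)
Definition dec a i : idx := [ffun k => (a k - (k == i))%N].

Lemma incK i : cancel (inc^~ i) (dec^~ i).
Proof. by move=> a; apply/ffunP => k; rewrite !ffunE addnK. Qed.

Lemma decK a i : (0 < a i)%N -> inc (dec a i) i = a.
Proof.
by move=> ai; apply/ffunP => k; rewrite !ffunE; case: eqVneq => [->|_];
  rewrite ?subn0 ?addn0// subnK.
Qed.

Definition hermiteN a x : R := \prod_k (hermite (a k)).[x 0 k].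

Definition hermfun a x : R := hermiteN a x * gaussian x.

Lemma hermiteN_mulx a i x :
  x 0 i * hermiteN a x = hermiteN (inc a i) x + (a i)%:R / 2 * hermiteN (dec a i) x.
Proof.
rewrite /hermiteN (bigD1 i)//= [X in _ = X + _](bigD1 i)//= [X in _ = _ + _ * X](bigD1 i)//=.
rewrite !ffunE eqxx addn1 subn1.
have h1 : \prod_(k < N | k != i) (hermite ((inc a i) k)).[x 0 k] =
  \prod_(k < N | k != i) (hermite (a k)).[x 0 k].
  by apply: eq_bigr => k /negbTE ki; rewrite ffunE ki addn0.
have h2 : \prod_(k < N | k != i) (hermite ((dec a i) k)).[x 0 k] =
  \prod_(k < N | k != i) (hermite (a k)).[x 0 k].
  by apply: eq_bigr => k /negbTE ki; rewrite ffunE ki subn0.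
rewrite h1 h2 !mulrA -mulrDl; congr (_ * _).
have := congr1 (fun p => p.[x 0 i]) (hermite_mulX (R := R) (a i)).
by rewrite hornerM hornerX hornerD hornerZ.
Qed.

Lemma hermfun_mulx a i x : x 0 i * hermfun a x = hermfun (inc a i) x + (a i)%:R / 2 *
  hermfun (dec a i) x.
Proof. by rewrite /hermfun mulrA hermiteN_mulx mulrDl mulrA. Qed.

(** Along a coordinate line a coordinate or a product of Hermite polynomials is a polynomial in the
    parameter, so directional derivatives reduce to formal ones. *)
Lemma is_derive_poly_line f x v (p : {poly R}) : (forall h : R, f (h *: v + x) = p.[h]) ->
  is_derive x v f (p^`()).[0].
Proof.
move=> fp.
have E : (fun h : R => h^-1 *: ((f \o shift x) (h *: v) - f x)) =
         (fun h : R => h^-1 *: ((horner p \o shift 0) (h *: (1 : R)) - p.[0])).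
  apply/funext => h /=; rewrite -(fp 0) scale0r add0r fp.
  by congr (_ *: (p.[_] - _)); rewrite addr0 [RHS]mulr1.
apply: DeriveDef; first by rewrite /derivable E; exact: derivable_horner.
by rewrite /derive E; have [_ <-] := is_derive_poly p 0.
Qed.

Lemma is_derive_coord x i j : is_derive x (delta_mx 0 i) (fun x : 'rV[R]_N => x 0 j) (i ==
  j)%:R.
Proof.
apply: (is_derive_eq (is_derive_poly_line (p := (i == j)%:R *: 'X + (x 0 j)%:P) _)).
  by move=> h; rewrite !mxE eqxx /= !hornerE mulrC eq_sym.
by rewrite derivD derivZ derivX derivC !hornerE.
Qed.

Lemma is_derive_gaussian x i : is_derive x (delta_mx 0 i) (@gaussian R N) (- x 0 i *
  gaussian x).
Proof.
pose p : {poly R} := - 2^-1 *: ('X ^+ 2 + (2 * x 0 i) *: 'X + (sqnorm x)%:P).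
have hp h : - (sqnorm (h *: delta_mx 0 i + x) / 2) = p.[h].
  rewrite /p !hornerE !sqnorm_row (bigD1 i)//= [X in _ = _ * (_ + X)](bigD1 i)//=.
  rewrite !mxE !eqxx (eq_bigr (fun k => x 0 k ^+ 2)); first by rewrite /=; field.
  by move=> k ki; rewrite !mxE eqxx (negbTE ki) /= mulr0 add0r.
have E : (fun h : R => h^-1 *: ((@gaussian R N \o shift x) (h *: delta_mx 0 i) - gaussian x)) =
         (fun h : R => h^-1 *: (((expR \o horner p) \o shift 0) (h *: (1 : R)) - (expR \o
           horner p) 0)).
  apply/funext => h /=; rewrite /gaussian -(hp 0) scale0r add0r hp.
  by congr (_ *: (expR p.[_] - _)); rewrite addr0 [RHS]mulr1.
have d := @is_derive1_comp R expR (horner p) 0 _ _ (is_derive_expR _) (is_derive_poly p 0).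
have [d1 d2] := d.
apply: DeriveDef; first by rewrite /derivable E; exact: d1.
rewrite /derive E; apply: etrans d2 _; rewrite /GRing.scale/=.
rewrite -(hp 0) scale0r add0r mulrC -/(gaussian x); congr (_ * _).
by rewrite /p derivZ !derivD derivXn derivZ derivX derivC !hornerE /=; field.
Qed.

Lemma is_derive_hermiteN a x i :
  is_derive x (delta_mx 0 i) (hermiteN a) ((a i)%:R * hermiteN (dec a i) x).
Proof.
pose C := \prod_(k < N | k != i) (hermite (a k)).[x 0 k].
apply: (is_derive_eq (is_derive_poly_line (p := C *: (hermite (a i) \Po ('X + (x 0 i)%:P))) _)).
  move=> h; rewrite /hermiteN (bigD1 i)//= !mxE !eqxx mulrC hornerZ horner_comp !hornerE.
  congr (_ * _); apply: eq_bigr => k ki.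
  by rewrite !mxE (negbTE ki) andbF /= mulr0 add0r.
rewrite derivZ deriv_comp derivD derivX derivC addr0 mulr1 hornerZ horner_comp !hornerE.
rewrite deriv_hermite hornerZ /hermiteN (bigD1 i)//= ffunE eqxx subn1 mulrCA; congr (_ * _).
rewrite mulrC; congr (_ * _); apply: eq_bigr => k ki.
by rewrite ffunE (negbTE ki) subn0.
Qed.

(** Together with [hermfun_mulx] this gives the ladder operators: d_i + x_i sends h_a to a_i h_{a -
    e_i}, and x_i - d_i sends h_a to 2 h_{a + e_i}. *)
Lemma is_derive_hermfun a x i :
  is_derive x (delta_mx 0 i) (hermfun a) ((a i)%:R / 2 * hermfun (dec a i) x - hermfun (inc
    a i) x).
Proof.
have h1 := is_derive_hermiteN a x i; have h2 := is_derive_gaussian x i.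
apply: (is_derive_eq (is_deriveM h1 h2)).
have := hermfun_mulx a i x; rewrite /GRing.scale/= /hermfun => h.
have -> : hermiteN a x * (- x 0 i * gaussian x) = - (x 0 i * (hermiteN a x * gaussian x)) by
  ring.
by rewrite h; field.
Qed.

Lemma partial_hermfun a i : partial i (hermfun a) = fun x => (a i)%:R / 2 * hermfun (dec a
  i) x - hermfun (inc a i) x.
Proof. by apply/funext => x; have [_ <-] := is_derive_hermfun a x i. Qed.

Lemma derivable_hermfun a i x : derivable (hermfun a) x (delta_mx 0 i).
Proof. by have [] := is_derive_hermfun a x i. Qed.

Lemma continuous_mulf f g : continuous f -> continuous g -> continuous (fun x => f x * g x).
Proof. by move=> cf cg x; exact: cvgM (cf x) (cg x). Qed.

Lemma continuous_addf f g : continuous f -> continuous g -> continuous (fun x => f x + g x).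
Proof. by move=> cf cg x; exact: cvgD (cf x) (cg x). Qed.

Lemma continuous_coord i : continuous (fun x : 'rV[R]_N => x 0 i).
Proof. by move=> x; exact: coord_continuous. Qed.

Lemma continuous_sqnorm : continuous (@sqnorm R 1 N).
Proof.
rewrite (_ : @sqnorm R 1 N = fun x => \sum_i x 0 i ^+ 2); last by apply/funext => x;
  rewrite sqnorm_row.
elim: (index_enum _) => [|k s IH].
  rewrite (_ : (fun _ => _) = fun=> 0) ; first exact: cst_continuous.
  by apply/funext => x; rewrite big_nil.
rewrite (_ : (fun _ => _) = fun x => x 0 k * x 0 k + \sum_(i <- s) x 0 i ^+ 2).
  by apply: continuous_addf => //; apply: continuous_mulf; exact: continuous_coord.
by apply/funext => x; rewrite big_cons expr2.
Qed.

Lemma continuous_gaussian : continuous (@gaussian R N).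
Proof.
move=> x; apply: (@continuous_comp _ _ _ (fun x => - (sqnorm x / 2)) expR);
  last exact: continuous_expR.
have h : continuous (fun x : 'rV[R]_N => sqnorm x * 2^-1).
  by apply: continuous_mulf; [exact: continuous_sqnorm|exact: cst_continuous].
exact: cvgN (h x).
Qed.

Lemma continuous_hermiteN a : continuous (hermiteN a).
Proof.
rewrite /hermiteN; elim: (index_enum _) => [|k s IH].
  rewrite (_ : (fun _ => _) = fun=> 1) ; first exact: cst_continuous.
  by apply/funext => x; rewrite big_nil.
rewrite (_ : (fun _ => _) = fun x => (hermite (a k)).[x 0 k] * \prod_(i <- s) (hermite (a
  i)).[x 0 i]).
  apply: continuous_mulf => // x.
  apply: (@continuous_comp _ _ _ (fun x : 'rV[R]_N => x 0 k) (horner (hermite (a k)))).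
    exact: continuous_coord.
  exact: continuous_horner.
by apply/funext => x; rewrite big_cons.
Qed.

Lemma continuous_hermfun a : continuous (hermfun a).
Proof. exact: continuous_mulf (@continuous_hermiteN a) continuous_gaussian. Qed.

Lemma measurable_hermfun a : measurableN (hermfun a).
Proof. by apply: continuous_measurableN; exact: continuous_hermfun. Qed.

(** A class that contains the polynomials, is stable under products (split the rate e in two) and is
    integrable against every Gaussian (spend half of its rate), with no degree to keep track of. *)
Definition slowly_growing f := forall e : R, 0 < e -> exists C : R,
  forall x, `|f x| <= C * expR (e * sqnorm x).

Lemma sqnorm_ge0 x : 0 <= sqnorm x.
Proof. by rewrite sqnorm_row sumr_ge0// => i _; exact: sqr_ge0. Qed.

Lemma slowly_growing_cst (c : R) : slowly_growing (fun=> c).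
Proof.
move=> e e0; exists `|c| => x; rewrite ler_peMr// -[X in X <= _]expR0 ler_expR.
by rewrite mulr_ge0 ?sqnorm_ge0// ltW.
Qed.

Lemma slowly_growingD f g : slowly_growing f -> slowly_growing g -> slowly_growing (fun x =>
  f x + g x).
Proof.
move=> hf hg e e0; have [C hC] := hf _ e0; have [D hD] := hg _ e0.
by exists (C + D) => x; rewrite mulrDl (le_trans (ler_normD _ _))// lerD.
Qed.

Lemma slowly_growingM f g : slowly_growing f -> slowly_growing g -> slowly_growing (fun x =>
  f x * g x).
Proof.
move=> hf hg e e0; have e2 : 0 < e / 2 by rewrite divr_gt0.
have [C hC] := hf _ e2; have [D hD] := hg _ e2.
exists (C * D) => x; rewrite normrM [e in expR (e * _)]splitr mulrDl expRD mulrACA.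
by apply: ler_pM.
Qed.

Lemma slowly_growing_coord i : slowly_growing (fun x => x 0 i).
Proof.
move=> e e0; exists (1 + e^-1) => x.
have h1 : `|x 0 i| <= 1 + sqnorm x.
  apply: (@le_trans _ _ (1 + x 0 i ^+ 2)).
    rewrite -[X in _ + X]real_normK ?num_real//.
    have := sqr_ge0 (`|x 0 i| - 1); have := normr_ge0 (x 0 i);
      rewrite sqrrB expr1n mulr1 => h2 h3.
    lra.
  by rewrite lerD2l sqnorm_row (bigD1 i)//= lerDl sumr_ge0// => k _; exact: sqr_ge0.
apply: (le_trans h1); apply: (@le_trans _ _ ((1 + e^-1) * (1 + e * sqnorm x))).
  have e0' : 0 <= e^-1 by rewrite invr_ge0 ltW.
  rewrite mulrDl mul1r mulrDr mulr1 mulrA mulVf ?gt_eqF// mul1r.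
  have := mulr_ge0 (ltW e0) (sqnorm_ge0 x); lra.
apply: ler_wpM2l; last exact: expR_ge1Dx.
by rewrite addr_ge0// invr_ge0 ltW.
Qed.

Lemma slowly_growing_horner (p : {poly R}) i : slowly_growing (fun x => p.[x 0 i]).
Proof.
elim/poly_ind: p => [|p c IH].
  by have := slowly_growing_cst 0; congr slowly_growing; apply/funext => x; rewrite horner0.
have := slowly_growingD (slowly_growingM IH (slowly_growing_coord i)) (slowly_growing_cst c).
by congr slowly_growing; apply/funext => x; rewrite !hornerE.
Qed.

Lemma slowly_growing_hermiteN a : slowly_growing (hermiteN a).
Proof.
rewrite /hermiteN; elim: (index_enum _) => [|k s IH].
  by have := slowly_growing_cst 1; congr slowly_growing; apply/funext => x; rewrite big_nil.
have := slowly_growingM (slowly_growing_horner (hermite (a k)) k) IH.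
by congr slowly_growing; apply/funext => x; rewrite big_cons.
Qed.

Lemma slowly_growing_integrable f (c : R) : measurableN f -> slowly_growing f -> 0 < c ->
  integrableN (fun x => f x * expR (- (c * sqnorm x))).
Proof.
move=> mf sf c0; have c2 : 0 < c / 2 by rewrite divr_gt0.
have [C hC] := sf _ c2.
apply: (le_integrableN (g := fun x => C * expR (- (c / 2 * sqnorm x)))).
- by apply: measurable_funM => //; exact: measurable_expN_sqnorm.
- apply: integrableNZ; apply: ge0_integrableN; first exact: measurable_expN_sqnorm.
    by move=> x; exact: expR_ge0.
  by have [r _ ->] := integral_expN_sqnorm N c2; rewrite ltry.
move=> x; rewrite normrM [X in _ * X]ger0_norm ?expR_ge0//.
have -> : - (c * sqnorm x) = - (c / 2 * sqnorm x) - c / 2 * sqnorm x by field.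
rewrite expRD mulrA ler_pM2r ?expR_gt0//.
by rewrite expRN ler_pdivrMr ?expR_gt0.
Qed.

Lemma L2_hermfun a : L2 (hermfun a).
Proof.
apply: integrableN_L2; first exact: measurable_hermfun.
have sh := slowly_growing_hermiteN a.
have mh : measurableN (hermiteN a) by apply: continuous_measurableN; exact: continuous_hermiteN.
have mh2 : measurableN (fun x => hermiteN a x * hermiteN a x) by exact: measurable_funM.
have := slowly_growing_integrable mh2 (slowly_growingM sh sh) ltr01.
congr integrableN; apply/funext => x; rewrite /hermfun exprMn -expr2; congr (_ * _).
by rewrite /gaussian -expRM_natl; congr expR; field.
Qed.

End HermiteFunctions.

(** * Integration by parts and orthogonality of the Hermite functions *)

Section IntegrationByParts.
Context {R : realType} {N : nat}.
Notation F := ('rV[R]_N -> R).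
Notation idx := {ffun 'I_N -> nat}.
Notation hermfun := (@hermfun R N).
Implicit Types (f g : F) (x : 'rV[R]_N) (a b : idx) (i j : 'I_N).

Definition C1_along i f := [/\ continuous f, forall x,
  derivable f x (delta_mx 0 i) & continuous (partial i f)].

Lemma C1_alongM i f g : C1_along i f -> C1_along i g ->
  C1_along i (fun x => f x * g x) /\
  partial i (fun x => f x * g x) = fun x => f x * partial i g x + partial i f x * g x.
Proof.
move=> [cf df cdf] [cg dg cdg].
have E : partial i (fun x => f x * g x) = fun x => f x * partial i g x + partial i f x * g x.
  apply/funext => x; rewrite /partial (deriveM (df x) (dg x)) /GRing.scale/=.
  by rewrite [g x * _]mulrC.
split; last exact: E.
split; first exact: (continuous_mulf cf cg).
  by move=> x; exact: derivableM (df x) (dg x).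
by rewrite E; exact: (continuous_addf (continuous_mulf cf cdg) (continuous_mulf cdf cg)).
Qed.

Lemma C1_hermfun i a : C1_along i (hermfun a).
Proof.
split; [exact: continuous_hermfun|by move=> x; exact: derivable_hermfun|].
rewrite partial_hermfun.
have -> : (fun x => (a i)%:R / 2 * hermfun (dec a i) x - hermfun (inc a i) x) =
    (fun x => (a i)%:R / 2 * hermfun (dec a i) x + (-1) * hermfun (inc a i) x).
  by apply/funext => x; rewrite mulN1r.
apply: continuous_addf; apply: continuous_mulf; (try by apply: cst_continuous);
  exact: (@continuous_hermfun R N).
Qed.

Lemma L2_partial_hermfun i a : L2 (partial i (hermfun a)).
Proof. rewrite partial_hermfun; by apply: L2B; [apply: L2Z|]; exact: (@L2_hermfun R N). Qed.

Lemma integration_by_parts_along i f g : C1_along i f -> C1_along i g ->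
  L2 f -> L2 (partial i f) -> L2 g -> L2 (partial i g) ->
  ip (partial i f) g + ip f (partial i g) = 0.
Proof.
move=> cf cg lf ldf lg ldg.
have [[h1 h2 h3] E] := C1_alongM cf cg.
have i1 := L2M lf ldg; have i2 := L2M ldf lg.
have := integralN_partial h1 h2 h3 (L2M lf lg); rewrite E => /(_ (integrableND i1 i2)).
by rewrite integralND// !ipE// -EFinD => -[<-]; rewrite addrC.
Qed.

(** The partial derivative is antisymmetric and multiplication by x_i is symmetric, so raising in
    the first argument becomes lowering in the second. *)
Lemma ip_partial_hermfun i a b :
  ip (hermfun (inc a i)) (hermfun b) = (b i)%:R / 2 * ip (hermfun a) (hermfun (dec b i)).
Proof.
have L c := @L2_hermfun R N c.
have h1 : ip (partial i (hermfun a)) (hermfun b) + ip (hermfun a) (partial i (hermfun b)) = 0.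
  by apply: integration_by_parts_along; (try exact: C1_hermfun); (try exact: L);
    exact: L2_partial_hermfun.
have h2 : ip (fun x => hermfun (inc a i) x + (a i)%:R / 2 * hermfun (dec a i) x) (hermfun b) =
    ip (hermfun a) (fun x => hermfun (inc b i) x + (b i)%:R / 2 * hermfun (dec b i) x).
  congr (fine (integralN _)); apply/funext => x.
  by rewrite -!hermfun_mulx; ring.
have LZ c d := L2Z c (L d).
move: h1 h2; rewrite !partial_hermfun ipBl// ipBr// ipDl// ipDr// !ipZl// !ipZr// => h1 h2.
lra.
Qed.

(** This number is pi^(N/2); it is kept symbolic, since its positivity suffices. *)
Definition gauss_mass : R := ip (@gaussian R N) (@gaussian R N).

Lemma gauss_mass_gt0 : 0 < gauss_mass.
Proof.
have [r r0 hr] := integral_expN_sqnorm N (ltr01 : 0 < 1 :> R).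
rewrite /gauss_mass /ip (_ : (fun x => _) = fun x => expR (- (1 * sqnorm x))) ?hr//.
by apply/funext => x; rewrite /gaussian -expRD; congr expR; field.
Qed.

Definition hnorm a : R := gauss_mass * \prod_k ((a k)`!%:R / 2 ^+ a k).

Lemma hnorm_gt0 a : 0 < hnorm a.
Proof.
by rewrite /hnorm mulr_gt0 ?gauss_mass_gt0// prodr_gt0// => k _;
  rewrite divr_gt0 ?exprn_gt0// ltr0n fact_gt0.
Qed.

Lemma hnorm_inc a i : hnorm (inc a i) = (a i).+1%:R / 2 * hnorm a.
Proof.
rewrite /hnorm (bigD1 i)//= [X in _ = _ * (_ * X)](bigD1 i)//= ffunE eqxx addn1.
rewrite [X in _ * (_ * X) = _](eq_bigr (fun k => (a k)`!%:R / 2 ^+ a k)); last first.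
  by move=> k /negbTE ki; rewrite ffunE ki addn0.
have h : 2 ^+ a i != 0 :> R by rewrite expf_neq0.
by rewrite factS natrM exprS; field.
Qed.

Definition deg a := (\sum_k a k)%N.

Lemma deg_inc a i : deg (inc a i) = (deg a).+1.
Proof.
rewrite /deg (bigD1 i)//= [in RHS](bigD1 i)//= ffunE eqxx addn1 addSn.
by congr (_ + _).+1; apply: eq_bigr => k /negbTE ki; rewrite ffunE ki addn0.
Qed.

Lemma deg_gt0P a : (0 < deg a)%N -> exists i, (0 < a i)%N.
Proof.
move=> a0; apply/existsP; apply: contraTT a0 => /existsPn h.
by rewrite -leqNgt leqn0 /deg big1// => k _; apply/eqP; rewrite -leqn0 leqNgt h.
Qed.

Lemma deg_eq0 a : deg a = 0%N -> a = [ffun=> 0%N].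
Proof.
by move=> /eqP; rewrite sum_nat_eq0 => /forallP h; apply/ffunP => k; rewrite ffunE; apply/eqP/h.
Qed.

Lemma hermfun0 : hermfun [ffun=> 0%N] = @gaussian R N.
Proof.
apply/funext => x; rewrite /hermfun /hermiteN big1 ?mul1r// => k _.
by rewrite ffunE hornerC.
Qed.

(** Induction on the degree of [a]: for an index with [a i] positive, the adjunction
    [ip_partial_hermfun] lowers both multi-indices at [i], or gives 0 when [b i] is 0. *)
Lemma ip_hermfun a b : ip (hermfun a) (hermfun b) = (a == b)%:R * hnorm a.
Proof.
have [n] := ubnP (deg a); elim: n a b => // n IH a b /ltnSE an.
have [a0|a0] := posnP (deg a).
  have [b0|b0] := posnP (deg b).
    rewrite (deg_eq0 a0) (deg_eq0 b0) eqxx mul1r hermfun0 /hnorm big1 ?mulr1// => k _.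
    by rewrite ffunE expr0 divr1.
  have [i bi] := deg_gt0P b0.
  rewrite -(decK bi) ipC ip_partial_hermfun (deg_eq0 a0) ffunE mul0r mul0r.
  case: eqVneq => [h|_]; rewrite ?mul0r//.
  by have := congr1 (fun f : idx => f i) h; rewrite !ffunE eqxx addn1.
have [i ai] := deg_gt0P a0.
have := an; rewrite -{1}(decK ai) deg_inc => da.
rewrite -{1}(decK ai) ip_partial_hermfun IH//.
have [bi|bi] := posnP (b i).
  rewrite bi !mul0r; case: eqVneq => [h|_]; rewrite ?mul0r//.
  by move: ai; rewrite h bi.
have E : (a == b) = (dec a i == dec b i).
  by rewrite -[in LHS](decK ai) -[in LHS](decK bi) (can_eq (@incK N i)).
rewrite -E; case: eqVneq => [<-|_]; last by rewrite !mul0r mulr0.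
have -> : hnorm a = (a i)%:R / 2 * hnorm (dec a i).
  by rewrite -{1}(decK ai) hnorm_inc ffunE eqxx subn1 prednK.
by ring.
Qed.

End IntegrationByParts.

(** * Density of the Hermite functions *)

Section Density.
Context {R : realType} {N : nat}.
Notation mT := (measurableTypeR R).
Notation F := ('rV[R]_N -> R).
Notation idx := {ffun 'I_N -> nat}.
Notation hermfun := (@hermfun R N).
Notation row := (@row_of_tuple R N).
Implicit Types (f g p m : F) (x : 'rV[R]_N) (a b : idx) (i j : 'I_N).

(** A multi-index may occur several times in the list, so that adding two elements is
    concatenation. *)
Definition hermspan p := exists s : seq (R * idx), p = fun x => \sum_(q <- s) q.1 * hermfun
  q.2 x.

Lemma hermspan_hermfun a : hermspan (hermfun a).
Proof. by exists [:: (1, a)]; apply/funext => x; rewrite big_seq1 mul1r. Qed.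

Lemma hermspanD f g : hermspan f -> hermspan g -> hermspan (fun x => f x + g x).
Proof. by move=> [s ->] [t ->]; exists (s ++ t); apply/funext => x; rewrite big_cat. Qed.

Lemma hermspanZ (c : R) f : hermspan f -> hermspan (fun x => c * f x).
Proof.
move=> [s ->]; exists [seq (c * q.1, q.2) | q <- s]; apply/funext => x.
by rewrite big_map mulr_sumr; apply: eq_bigr => q _; rewrite mulrA.
Qed.

Lemma hermspan0 : hermspan (fun=> 0).
Proof. by exists [::]; apply/funext => x; rewrite big_nil. Qed.

Lemma hermspan_sum (I : Type) (s : seq I) (f : I -> F) : (forall k, hermspan (f k)) ->
  hermspan (fun x => \sum_(k <- s) f k x).
Proof.
move=> hf; elim: s => [|k s IH].
  by have := hermspan0; congr hermspan; apply/funext => x; rewrite big_nil.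
by have := hermspanD (hf k) IH; congr hermspan; apply/funext => x; rewrite big_cons.
Qed.

Lemma hermspan_mulx i f : hermspan f -> hermspan (fun x => x 0 i * f x).
Proof.
move=> [s ->].
have h : hermspan (fun x => \sum_(q <- s) q.1 * (hermfun (inc q.2 i) x + (q.2 i)%:R / 2 *
  hermfun (dec q.2 i) x)).
  apply: hermspan_sum => q; apply: hermspanZ; apply: hermspanD; first exact: hermspan_hermfun.
  by apply: hermspanZ; exact: hermspan_hermfun.
move: h; congr hermspan; apply/funext => x; rewrite mulr_sumr; apply: eq_bigr => q _.
by rewrite -hermfun_mulx; ring.
Qed.

Lemma hermspan_mul_sqnorm f : hermspan f -> hermspan (fun x => sqnorm x * f x).
Proof.
move=> hf.
have h : hermspan (fun x => \sum_(i <- index_enum 'I_N) x 0 i * (x 0 i * f x)).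
  by apply: hermspan_sum => i; do 2 apply: hermspan_mulx.
move: h; congr hermspan; apply/funext => x; rewrite sqnorm_row mulr_suml.
by apply: eq_bigr => i _; rewrite mulrA expr2.
Qed.

Lemma L2_hermspan f : hermspan f -> L2 f.
Proof. by move=> [s ->]; apply: L2_sum => q; apply: L2Z; exact: (@L2_hermfun R N). Qed.

Lemma hermspan_slowly_growing f : hermspan f ->
  exists2 q : F, measurableN q /\ slowly_growing q & f = fun x => q x * gaussian x.
Proof.
move=> [s ->]; exists (fun x => \sum_(q <- s) q.1 * hermiteN q.2 x).
  split.
    apply: measurable_sum => q; apply: measurable_funM => //.
    by apply: continuous_measurableN; exact: continuous_hermiteN.
  elim: s => [|q s IH].
    by have := @slowly_growing_cst R N 0; congr slowly_growing; apply/funext => x;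
      rewrite big_nil.
  have h := slowly_growingM (@slowly_growing_cst R N q.1) (@slowly_growing_hermiteN R N q.2).
  by have := slowly_growingD h IH; congr slowly_growing; apply/funext => x; rewrite big_cons.
by apply/funext => x; rewrite mulr_suml; apply: eq_bigr => q _; rewrite -mulrA.
Qed.

Definition approximable f := L2 f /\ forall e : R, 0 < e -> exists2 p : F, hermspan p &
  ip (fun x => f x - p x) (fun x => f x - p x) < e.

Lemma approximable_hermspan f : hermspan f -> approximable f.
Proof.
move=> hf; split; first exact: L2_hermspan.
move=> e e0; exists f => //; rewrite (_ : (fun x => _) = fun=> 0) ?ip0l//.
by apply/funext => x; rewrite subrr.
Qed.

Lemma ip_sqrD_le f g : L2 f -> L2 g ->
  ip (fun x => f x + g x) (fun x => f x + g x) <= 2 * ip f f + 2 * ip g g.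
Proof.
move=> lf lg; have := ip_ge0 (fun x => f x - g x).
by rewrite ip_sqrB// ip_sqrD// => h; lra.
Qed.

Lemma le_ip f g : measurableN f -> L2 g -> (forall x, `|f x| <= `|g x|) -> ip f f <= ip g g.
Proof.
move=> mf lg fg; have lf := le_L2 mf lg fg.
rewrite -lee_fin -!ipE//; apply: ge0_le_integral => //.
- by move=> t _; rewrite lee_fin -expr2 sqr_ge0.
- by apply/measurable_EFinP; apply: measurable_funM.
- by apply/measurable_EFinP; apply: measurable_funM; exact: lg.1.
- move=> t _; rewrite lee_fin -!expr2 -[f _ ^+ 2]real_normK ?num_real// -[g _ ^+
  2]real_normK ?num_real//.
  by rewrite lerXn2r// ?nnegrE.
Qed.

Lemma approximable_closed f : L2 f -> (forall e : R, 0 < e -> exists2 g : F, approximable g &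
  ip (fun x => f x - g x) (fun x => f x - g x) < e) -> approximable f.
Proof.
move=> lf h; split => // e e0; have e4 : 0 < e / 4 by rewrite divr_gt0.
have [g [lg hg] fg] := h _ e4; have [p hp gp] := hg _ e4.
exists p => //; have lp := L2_hermspan hp.
rewrite (_ : (fun x => f x - p x) = fun x => (f x - g x) + (g x - p x)); last first.
  by apply/funext => x; ring.
by apply: le_lt_trans (ip_sqrD_le (L2B lf lg) (L2B lg lp)) _; lra.
Qed.

Lemma approximableD f g : approximable f -> approximable g -> approximable (fun x => f x + g x).
Proof.
move=> [lf hf] [lg hg]; split; first exact: L2D.
move=> e e0; have e4 : 0 < e / 4 by rewrite divr_gt0.
have [p hp fp] := hf _ e4; have [q hq gq] := hg _ e4.
exists (fun x => p x + q x); first exact: hermspanD.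
have lp := L2_hermspan hp; have lq := L2_hermspan hq.
rewrite (_ : (fun x => f x + g x - (p x + q x)) = fun x => (f x - p x) + (g x - q x));
  last first.
  by apply/funext => x; ring.
by apply: le_lt_trans (ip_sqrD_le (L2B lf lp) (L2B lg lq)) _; lra.
Qed.

Lemma approximableZ (c : R) f : approximable f -> approximable (fun x => c * f x).
Proof.
move=> [lf hf]; split; first exact: L2Z.
move=> e e0; have ec : 0 < e / (c ^+ 2 + 1) by rewrite divr_gt0// ltr_wpDl ?sqr_ge0.
have [p hp fp] := hf _ ec; exists (fun x => c * p x); first exact: hermspanZ.
have lfp := L2B lf (L2_hermspan hp).
rewrite (_ : (fun x => c * f x - c * p x) = fun x => c * (f x - p x)); last first.
  by apply/funext => x; ring.
rewrite ipZl//; last exact: L2Z.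
rewrite ipZr//; move: fp; rewrite ltr_pdivlMr ?ltr_wpDl ?sqr_ge0// => fp.
by have := ip_ge0 (fun x => f x - p x) => h; apply: le_lt_trans fp; rewrite mulrA -expr2; lra.
Qed.

(** Dominated convergence: both [f] and [u n] are bounded by [g] in absolute value, so the squared
    difference is at most 4 g^2 and tends to 0 in mean. *)
Lemma approximable_lim (u : nat -> F) f g : (forall n,
  approximable (u n)) -> measurableN f -> L2 g ->
  (forall n x, `|u n x| <= `|g x|) -> (forall x, u n x @[n --> \oo] --> f x) -> approximable f.
Proof.
move=> du mf lg ug uf.
have fg x : `|f x| <= `|g x|.
  apply: (cvgr_to_le (cvg_norm (uf x))); near=> n; exact: ug.
have lf := le_L2 mf lg fg; apply: approximable_closed => // e e0.
have lu n : L2 (fun x => f x - u n x) by apply: L2B => //; exact: (du n).1.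
have ig : integrableN (fun x => 4 * g x ^+ 2) by apply: integrableNZ; exact: L2_sqr.
have mu_ n : measurable_fun setT (fun t => ((f (row t) - u n (row t)) ^+ 2)%:E).
  by apply/measurable_EFinP; apply: measurable_funX; exact: (lu n).1.
have [] := @dominated_convergence _ _ _ (@lebesgue_tuple R N) setT measurableT
  (fun n t => ((f (row t) - u n (row t)) ^+ 2)%:E) (fun=> 0%E)
  (fun t => (4 * g (row t) ^+ 2)%:E) mu_ (measurable_cst _) _ ig _.
- apply: aeW => t _ /=; apply: cvg_EFin; first by near=> n.
  rewrite -[X in _ --> X](expr0n R 2); under eq_fun do rewrite /= expr2.
  rewrite expr2 -(subrr (f (row t))); apply: cvgM; apply: cvgB; by [exact: cvg_cst|exact: uf].
- apply: aeW => t n _; rewrite /= lee_fin ger0_norm ?sqr_ge0//.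
  rewrite -[X in X <= _]real_normK ?num_real// -[g _ ^+ 2]real_normK ?num_real//.
  have -> : 4 * `|g (row t)| ^+ 2 = (2 * `|g (row t)|) ^+ 2 by ring.
  rewrite lerXn2r ?nnegrE ?mulr_ge0//; apply: le_trans (ler_normB _ _) _.
  by have := fg (row t); have := ug n (row t); lra.
move=> _ _; rewrite integral0 => /fine_cvg h.
have := cvgr_lt _ h _ e0.
move=> [n _ /(_ n (leqnn n)) hn]; exists (u n); first exact: du.
apply: le_lt_trans hn; rewrite le_eqVlt; apply/orP; left; apply/eqP.
by rewrite /ip /integralN /=; congr fine; apply: eq_integral => t _; rewrite expr2.
Unshelve. all: by end_near.
Qed.

(* Multipliers form an algebra which is closed under bounded pointwise limits. *)
Definition multiplier m := forall f, approximable f -> approximable (fun x => m x * f x).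

Lemma multiplierM m n : multiplier m -> multiplier n -> multiplier (fun x => m x * n x).
Proof.
move=> hm hn f df; have := hm _ (hn _ df); congr approximable; apply/funext => x.
by rewrite mulrA.
Qed.

Lemma multiplierD m n : multiplier m -> multiplier n -> multiplier (fun x => m x + n x).
Proof.
move=> hm hn f df; have := approximableD (hm _ df) (hn _ df); congr approximable;
  apply/funext => x.
by rewrite mulrDl.
Qed.

Lemma multiplier_cst (c : R) : multiplier (fun=> c).
Proof. by move=> f df; exact: approximableZ. Qed.

Lemma multiplier_sum (I : Type) (s : seq I) (m : I -> F) : (forall k, multiplier (m k)) ->
  multiplier (fun x => \sum_(k <- s) m k x).
Proof.
move=> hm; elim: s => [|k s IH].
  by have := multiplier_cst 0; congr multiplier; apply/funext => x; rewrite big_nil.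
by have := multiplierD (hm k) IH; congr multiplier; apply/funext => x; rewrite big_cons.
Qed.

Lemma multiplier_lim (u : nat -> F) m (c : R) : (forall n, multiplier (u n)) -> measurableN m ->
  (forall n x, `|u n x| <= c) -> (forall x, u n x @[n --> \oo] --> m x) -> multiplier m.
Proof.
move=> hu mm uc um f df; have lf := df.1.
apply: (@approximable_lim (fun n x => u n x * f x) _ (fun x => c * f x)).
- by move=> n; exact: hu.
- by apply: measurable_funM => //; exact: lf.1.
- exact: L2Z.
- move=> n x; rewrite !normrM ler_wpM2r//; apply: le_trans (uc n x) _; exact: ler_norm.
- by move=> x; apply: cvgM => //; exact: cvg_cst.
Qed.

(** A bounded function acts continuously on L^2, so it is enough to test it on the span instead of
    its closure. The bound [c] may vanish, whence the division by [c ^+ 2 + 1]. *)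
Lemma multiplier_bounded m (c : R) : measurableN m -> (forall x, `|m x| <= c) ->
  (forall p, hermspan p -> approximable (fun x => m x * p x)) -> multiplier m.
Proof.
move=> mm mc hm f [lf hf].
have lm g : L2 g -> L2 (fun x => m x * g x).
  move=> lg; apply: (le_L2 _ (L2Z c lg)); first by apply: measurable_funM => //; exact: lg.1.
  move=> x; rewrite !normrM ler_wpM2r//; apply: le_trans (mc x) _; exact: ler_norm.
apply: approximable_closed; first exact: lm.
move=> e e0; have ec : 0 < e / (c ^+ 2 + 1) by rewrite divr_gt0// ltr_wpDl ?sqr_ge0.
have [p hp fp] := hf _ ec; exists (fun x => m x * p x); first exact: hm.
have lfp := L2B lf (L2_hermspan hp).
rewrite (_ : (fun x => m x * f x - m x * p x) = fun x => m x * (f x - p x)); last first.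
  by apply/funext => x; ring.
apply: (@le_lt_trans _ _ (ip (fun x => c * (f x - p x)) (fun x => c * (f x - p x)))).
  apply: le_ip; [exact: (lm _ lfp).1|exact: L2Z|].
  move=> x; rewrite !normrM ler_wpM2r//; apply: le_trans (mc x) _; exact: ler_norm.
rewrite ipZl//; last exact: L2Z.
rewrite ipZr//; move: fp; rewrite ltr_pdivlMr ?ltr_wpDl ?sqr_ge0// => fp.
by have := ip_ge0 (fun x => f x - p x) => h; apply: le_lt_trans fp; rewrite mulrA -expr2; lra.
Qed.

End Density.

Section SignIteration.
Context {R : realType}.

(* A polynomial map of [-1, 1] into itself, with fixed points -1, 0 and 1, whose
   iterates converge to the sign function. *)
Definition sgstep (y : R) : R := (3 * y - y ^+ 3) / 2.

Lemma iter_sgstepN n y : iter n sgstep (- y) = - iter n sgstep y.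
Proof. by elim: n => //= n ->; rewrite /sgstep; field. Qed.

(** The factorisation of 1 - [sgstep] t shows that each step multiplies the distance to 1 by (1 -
    t)(2 + t)/2 <= 1 - t/2. The iterates never fall below the starting point y, so this is at most 1
    - y/2. *)
Lemma iter_sgstep_bounds n y : 0 < y <= 1 ->
  y <= iter n sgstep y <= 1 /\ 1 - iter n sgstep y <= (1 - y / 2) ^+ n.
Proof.
move=> /andP[y0 y1]; elim: n => [|n [/andP[]]]; first by rewrite expr0 lexx y1 /=;
  split => //; lra.
rewrite iterS; set t := iter n sgstep y => yt t1 ht.
have E : 1 - sgstep t = (1 - t) * ((1 - t) * (2 + t) / 2) by rewrite /sgstep; field.
have E2 : sgstep t - t = t * (1 - t) * (1 + t) / 2 by rewrite /sgstep; field.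
have t0 : 0 < t by exact: lt_le_trans yt.
have h1 : 0 <= 1 - sgstep t.
  by rewrite E !mulr_ge0 ?invr_ge0//; lra.
have h2 : 0 <= sgstep t - t.
  by rewrite E2 !mulr_ge0 ?invr_ge0//; lra.
have h3 : (1 - t) * (2 + t) / 2 <= 1 - y / 2.
  have : 0 <= t ^+ 2 by exact: sqr_ge0.
  have -> : (1 - t) * (2 + t) / 2 = 1 - t / 2 - t ^+ 2 / 2 by field.
  lra.
split; first by apply/andP; split; lra.
rewrite E exprSr; apply: ler_pM => //; first lra.
by rewrite !mulr_ge0 ?invr_ge0//; lra.
Qed.

Lemma iter_sgstep0 n : iter n sgstep 0 = 0.
Proof. by elim: n => //= n ->; rewrite /sgstep expr0n /= mulr0 subr0 mul0r. Qed.

Lemma norm_iter_sgstep n y : `|y| <= 1 -> `|iter n sgstep y| <= 1.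
Proof.
move=> y1; have [y0|y0|->] := ltgtP y 0; last by rewrite iter_sgstep0 normr0.
- have := @iter_sgstep_bounds n (- y); rewrite iter_sgstepN -[`|_|]normrN.
  rewrite oppr_gt0 y0 -(ltr0_norm y0) y1 => -[]// /andP[h1 h2] _.
  by rewrite ger0_norm// (le_trans _ h1).
- have := @iter_sgstep_bounds n y.
  rewrite y0 -(gtr0_norm y0) y1 gtr0_norm// => -[]// /andP[h1 h2] _.
  by rewrite ger0_norm// (le_trans _ h1)// ltW.
Qed.

Lemma cvg_iter_sgstep_pos y : 0 < y <= 1 -> iter n sgstep y @[n --> \oo] --> (1 : R).
Proof.
move=> y01; have /andP[y0 y1] := y01.
have z1 : `|1 - y / 2| < 1 by rewrite ger0_norm; lra.
apply: (squeeze_cvgr (f := fun n => 1 - (1 - y / 2) ^+ n) (h := fun=> 1)).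
- near=> n; have [/andP[h1 h2] h3] := iter_sgstep_bounds n y01.
  by rewrite h2 andbT; lra.
- rewrite -[in X in _ --> X](subr0 1); apply: cvgB; first exact: cvg_cst.
  exact: cvg_expr.
- exact: cvg_cst.
Unshelve. all: by end_near.
Qed.

Lemma cvg_iter_sgstep y : `|y| <= 1 -> iter n sgstep y @[n --> \oo] --> Num.sg y.
Proof.
move=> y1; have [y0|y0|->] := ltgtP y 0.
- rewrite ltr0_sg// (_ : (fun n => _) = fun n => - iter n sgstep (- y)); last first.
    by apply/funext => n; rewrite iter_sgstepN opprK.
  apply: cvgN; apply: cvg_iter_sgstep_pos.
  by rewrite oppr_gt0 y0 -(ltr0_norm y0).
- by rewrite gtr0_sg//; apply: cvg_iter_sgstep_pos; rewrite y0 -(gtr0_norm y0).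
- by rewrite sgr0; under eq_fun do rewrite iter_sgstep0; exact: cvg_cst.
Qed.

End SignIteration.

(** * From multipliers to density in L^2 *)

Section DensityL2.
Context {R : realType} {N : nat}.
Notation mT := (measurableTypeR R).
Notation F := ('rV[R]_N -> R).
Notation idx := {ffun 'I_N -> nat}.
Notation hermfun := (@hermfun R N).
Notation row := (@row_of_tuple R N).
Implicit Types (f g p m : F) (x : 'rV[R]_N) (a b : idx) (i j : 'I_N).

Definition cutoff i (c : R) : F := fun x =>
  (1 + `|c|)^-1 * (x 0 i - c) * expR (- (sqnorm x / 4)).

Lemma continuous_cutoff i c : continuous (cutoff i c).
Proof.
apply: continuous_mulf.
  apply: continuous_mulf; first exact: cst_continuous.
  by apply: continuous_addf; [exact: continuous_coord|exact: cst_continuous].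
move=> x; apply: (@continuous_comp _ _ _ (fun x => - (sqnorm x / 4)) expR);
  last exact: continuous_expR.
have h : continuous (fun x : 'rV[R]_N => sqnorm x * 4^-1).
  by apply: continuous_mulf; [exact: continuous_sqnorm|exact: cst_continuous].
exact: cvgN (h x).
Qed.

Lemma cutoff_le1 i c x : `|cutoff i c x| <= 1.
Proof.
have c0 : 0 < 1 + `|c| by rewrite ltr_wpDr.
rewrite /cutoff !normrM normfV (gtr0_norm c0) (ger0_norm (expR_ge0 _)).
rewrite expRN ler_pdivrMr ?expR_gt0// mul1r mulrC ler_pdivrMr//.
have h1 : `|x 0 i| <= 1 + sqnorm x / 4.
  apply: (@le_trans _ _ (1 + x 0 i ^+ 2 / 4)).
    rewrite -[X in _ + X / _]real_normK ?num_real//.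
    have := sqr_ge0 (`|x 0 i| / 2 - 1); rewrite sqrrB expr_div_n expr1n => h; lra.
  by rewrite lerD2l ler_pM2r ?invr_gt0// sqnorm_row (bigD1 i)//= lerDl sumr_ge0// => k _;
    exact: sqr_ge0.
have h2 := expR_ge1Dx (sqnorm x / 4).
have h3 : 1 <= expR (sqnorm x / 4) by apply: le_trans h2; have := sqnorm_ge0 x; lra.
apply: le_trans (ler_normB _ _) _; rewrite mulrDr mulr1 lerD//.
  exact: le_trans h1 h2.
by rewrite ler_peMl.
Qed.

Lemma hermspan_mul_sqnormX f n : hermspan f -> hermspan (fun x => sqnorm x ^+ n * f x).
Proof.
move=> hf; elim: n => [|n IH].
  by move: hf; congr hermspan; apply/funext => x; rewrite expr0 mul1r.
have := hermspan_mul_sqnorm IH; congr hermspan; apply/funext => x.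
by rewrite exprS mulrA.
Qed.

Lemma norm_series_exp_le (y : R) n : `|series (exp_coeff y) n| <= expR `|y|.
Proof.
apply: (@le_trans _ _ (series (exp_coeff `|y|) n)).
  rewrite /series /=; apply: le_trans (ler_norm_sum _ _ _) _.
  by apply: ler_sum => k _; rewrite /exp_coeff /= normrM normrX normfV normr_nat.
rewrite /expR; apply: nondecreasing_cvgn_le; last exact: is_cvg_series_exp_coeff.
by apply: nondecreasing_series => k _ _; exact: exp_coeff_ge0.
Qed.

(** The partial sums of the exponential series are polynomials in |x|^2, so they keep [P] in the
    span. They are dominated by e^{|x|^2/4}, and since [P] carries e^{-|x|^2/2} the product with
    this majorant is still in L^2. *)
Lemma multiplier_cutoff i c : multiplier (cutoff i c).
Proof.
apply: (@multiplier_bounded _ _ _ 1).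
- by apply: continuous_measurableN; exact: continuous_cutoff.
- exact: cutoff_le1.
move=> p hp.
pose P x := (1 + `|c|)^-1 * (x 0 i - c) * p x.
have hP : hermspan P.
  have := hermspanZ (1 + `|c|)^-1 (hermspanD (hermspan_mulx i hp) (hermspanZ (- c) hp)).
  by congr hermspan; apply/funext => x; rewrite /P; ring.
pose y x : R := - (sqnorm x / 4).
have my : measurableN (cutoff i c) by apply: continuous_measurableN; exact: continuous_cutoff.
apply: (@approximable_lim _ _ (fun n x => series (exp_coeff (y x)) n * P x) _
  (fun x => expR (sqnorm x / 4) * P x)).
- move=> n; apply: approximable_hermspan.
  have h : hermspan (fun x => \sum_(k <- index_iota 0 n) ((- 4^-1) ^+ k / k`!%:R) * (sqnorm
    x ^+ k * P x)).
    by apply: hermspan_sum => k; apply: hermspanZ; exact: hermspan_mul_sqnormX.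
  move: h; congr hermspan; apply/funext => x; rewrite /series /= mulr_suml.
  apply: eq_bigr => k _; rewrite /exp_coeff /= /y -mulrN mulrC [in RHS]exprMn.
  by ring.
- by apply: measurable_funM => //; exact: (L2_hermspan hp).1.
- have [q [mq sq] Pq] := hermspan_slowly_growing hP.
  apply: integrableN_L2.
    apply: measurable_funM; last exact: (L2_hermspan hP).1.
    have := @measurable_expN_sqnorm R N (- 4^-1); congr (measurable_fun _ _).
    by apply/funext => t /=; congr expR; ring.
  have mq2 : measurableN (fun x => q x * q x) by exact: measurable_funM.
  have := slowly_growing_integrable mq2 (slowly_growingM sq sq) (ltac:(lra) : 0 < 2^-1 :> R).
  congr integrableN; apply/funext => x; rewrite Pq /gaussian.
  have -> : expR (- (2^-1 * sqnorm x)) = expR (sqnorm x / 4) ^+ 2 * expR (- (sqnorm x / 2))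
    ^+ 2.
    by rewrite -!expRM_natl -expRD; congr expR; field.
  by ring.
- move=> n x; rewrite !normrM ler_wpM2r// ?normr_ge0// [X in _ <= X]ger0_norm ?expR_ge0//.
  apply: le_trans (norm_series_exp_le _ _) _.
  by rewrite ler_expR /y normrN ger0_norm// divr_ge0 ?sqnorm_ge0.
- move=> x; have -> : cutoff i c x * p x = expR (y x) * P x by rewrite /cutoff /P /y; ring.
  apply: cvgM; last exact: cvg_cst.
  exact: (is_cvg_series_exp_coeff (y x)).
Qed.

Lemma multiplier_sgstep m n : multiplier m -> multiplier (fun x => iter n sgstep (m x)).
Proof.
move=> hm; elim: n => // n IH.
have := multiplierD (multiplierM (multiplier_cst (3 / 2)) IH)
  (multiplierM (multiplier_cst (- 2^-1)) (multiplierM IH (multiplierM IH IH))).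
congr multiplier; apply/funext => x; rewrite iterS /sgstep.
by field.
Qed.

Lemma multiplier_ray i (c : R) : multiplier (fun x => \1_(`]c, +oo[%classic) (x 0 i)).
Proof.
pose s n x := iter n sgstep (cutoff i c x).
have ms n : multiplier (s n) by apply: multiplier_sgstep; exact: multiplier_cutoff.
have s1 n x : `|s n x| <= 1 by apply: norm_iter_sgstep; exact: cutoff_le1.
(* For sigma the sign of [x 0 i - c], (sigma^2 + sigma)/2 is exactly the indicator of the open ray,
   also at the end point where sigma is 0. *)
apply: (@multiplier_lim _ _ (fun n x => 2^-1 * (s n x * s n x + s n x)) _ 1).
- move=> n; apply: multiplierM; first exact: multiplier_cst.
  by apply: multiplierD => //; exact: multiplierM.
- apply: (measurableT_comp (f := \1_(`]c, +oo[%classic) : mT -> R)).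
    exact: measurable_indic.
  exact: (measurable_coord i).
- move=> n x; rewrite normrM ger0_norm ?invr_ge0// mulrC ler_pdivrMr// mul1r.
  apply: le_trans (ler_normD _ _) _; rewrite normrM -[2]/(1 + 1) lerD//.
  by rewrite -[1]mulr1 ler_pM.
- move=> x; have hs : s n x @[n --> \oo] --> Num.sg (cutoff i c x).
    by apply: cvg_iter_sgstep; exact: cutoff_le1.
  have -> : \1_(`]c, +oo[%classic) (x 0 i) = 2^-1 * (Num.sg (cutoff i c x) * Num.sg (cutoff
    i c x) + Num.sg (cutoff i c x)) :> R.
    have c0 : 0 < (1 + `|c|)^-1 by rewrite invr_gt0 ltr_wpDr.
    rewrite indicE /cutoff !sgrM (gtr0_sg c0) (gtr0_sg (expR_gt0 _)) mul1r mulr1.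
    rewrite mem_setE in_itv /= andbT; have [h|h|h] := ltgtP c (x 0 i).
    + by rewrite gtr0_sg ?subr_gt0// mulr1 -[1 + 1]/2 mulVf.
    + by rewrite ltr0_sg ?subr_lt0// mulrNN mulr1 addrN mulr0.
    + by rewrite h subrr sgr0 mulr0 addr0 mulr0.
  apply: cvgM; first exact: cvg_cst.
  by apply: cvgD => //; exact: cvgM.
Qed.

Definition tup (x : 'rV[R]_N) : N.-tuple mT := [tuple (x 0 i : mT) | i < N].

Lemma tupK t : tup (row t) = t.
Proof. by apply: eq_from_tnth => i; rewrite tnth_mktuple mxE. Qed.

Definition multiplier_set (A : set (N.-tuple mT)) :=
  measurable A /\ multiplier (fun x => \1_A (tup x)).

Lemma measurable_indicN (A : set (N.-tuple mT)) : measurable A -> measurableN (fun x => \1_A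
  (tup x) : R).
Proof.
move=> mA; rewrite /measurableN (_ : _ \o _ = (\1_A : _ -> R)); first exact: measurable_indic.
by apply/funext => t /=; rewrite tupK.
Qed.

Lemma multiplier_set_sigma_algebra : sigma_algebra setT multiplier_set.
Proof.
split.
- split => //; have := @multiplier_cst R N 0; congr multiplier; apply/funext => x.
  by rewrite indic0.
- move=> A [mA hA]; split; first exact: measurableD.
  have := multiplierD (@multiplier_cst R N 1) (multiplierM (@multiplier_cst R N (-1)) hA).
  congr multiplier; apply/funext => x; rewrite setTD !indicE in_setC.
  by case: (_ \in A) => /=; ring.
- move=> A hA; split; first by apply: bigcupT_measurable => k; exact: (hA k).1.
  (* The indicator of the union of the first n sets, as a polynomial in their indicators. *)
  pose u n x : R := 1 - \prod_(k <- index_iota 0 n) (1 - \1_(A k) (tup x)).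
  have u01 n x : `|u n x| <= 1.
    have : 0 <= \prod_(k <- index_iota 0 n) (1 - \1_(A k) (tup x) : R) <= 1.
      apply/andP; split; first by apply: prodr_ge0 => k _; rewrite indicE; case: (_ \in _);
        rewrite ?subrr ?subr0.
      by apply: prodr_ile1 => k _; rewrite indicE; case: (_ \in _);
        rewrite ?subrr ?subr0 lexx ler01.
    by move=> /andP[h1 h2]; rewrite /u ger0_norm; lra.
  apply: (@multiplier_lim _ _ u _ 1) => //.
  + move=> n.
    have hp : multiplier (fun x => \prod_(k <- index_iota 0 n) (1 - \1_(A k) (tup x))).
      elim: (index_iota _ _) => [|k s IH].
        by have := @multiplier_cst R N 1; congr multiplier; apply/funext => x; rewrite big_nil.
      have := multiplierM (multiplierD (@multiplier_cst R N 1) (multiplierM (@multiplier_cst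
        R N (-1)) (hA k).2)) IH.
      by congr multiplier; apply/funext => x; rewrite big_cons mulN1r.
    have := multiplierD (@multiplier_cst R N 1) (multiplierM (@multiplier_cst R N (-1)) hp).
    by congr multiplier; apply/funext => x; rewrite mulN1r.
  + by apply: measurable_indicN; apply: bigcupT_measurable => k; exact: (hA k).1.
  + move=> x; rewrite indicE; have [|] := boolP (_ \in _).
      rewrite inE => -[k _ Ak]; apply: cvg_near_cst; near=> n.
      rewrite /u (bigD1_seq k)//= ?iota_uniq// ?mem_index_iota /=; last by near: n;
        exact: nbhs_infty_gt.
      by rewrite indicE mem_set// subrr mul0r subr0.
    rewrite notin_setE => nA; apply: cvg_near_cst; near=> n.
    rewrite /u big1 ?subrr// => k _; rewrite indicE memNset ?subr0// => Ak.
    by apply: nA; exists k.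
Unshelve. all: by end_near.
Qed.

(** The product sigma-algebra is generated by the preimages of Borel sets under the coordinates, and
    these Borel sets by open rays, which [multiplier_ray] handles. *)
Lemma measurable_multiplier_set (A : set (N.-tuple mT)) : measurable A -> multiplier_set A.
Proof.
have [s0 sC sU] := multiplier_set_sigma_algebra.
apply: smallest_sub; first exact: multiplier_set_sigma_algebra.
apply: (big_ind (fun X => X `<=` multiplier_set)) => [B []//|X Y hX hY|i _].
  by rewrite subUset.
move=> _ [C mC <-]; rewrite setTI; move: C mC.
suff : measurable `<=` [set C : set mT | multiplier_set ((fun t => tnth t i) @^-1` C)] by [].
have -> : @measurable _ mT = (@RGenOInfty.G R).-sigma.-measurable by exact:
  RGenOInfty.measurableE.
apply: smallest_sub.
  split; rewrite /=.
  - by rewrite preimage_set0.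
  - by move=> D /sC; rewrite !setTD preimage_setC.
  - by move=> D hD; rewrite preimage_bigcup; exact: sU.
move=> _ [c ->] /=; split.
  rewrite -[X in measurable X]setTI; exact: (@measurable_tnth _ mT N i).
have := multiplier_ray i c; congr multiplier; apply/funext => x.
by rewrite -[x 0 i](tnth_mktuple (fun k => x 0 k : mT)).
Qed.

Import HBNNSimple.

(** The quotient of [f] by the Gaussian is an increasing limit of simple functions, which are
    multipliers. Applied to the Gaussian, itself in the span, they give functions that converge to
    [f] and are dominated by it. *)
Lemma approximable_ge0 f : L2 f -> (forall x, 0 <= f x) -> approximable f.
Proof.
move=> lf f0.
pose h (t : N.-tuple mT) : \bar R := (f (row t) / gaussian (row t))%:E.
have g0 x : 0 < @gaussian R N x by exact: expR_gt0.
have mh : measurable_fun setT h.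
  apply/measurable_EFinP; apply: measurable_funM; first exact: lf.1.
  have := @measurable_expN_sqnorm R N (- 2^-1); congr (measurable_fun _ _).
  by apply/funext => t /=; rewrite /gaussian -expRN; congr expR; ring.
have h0 t : [set: N.-tuple mT] t -> (0 <= h t)%E.
  by move=> _; rewrite lee_fin divr_ge0// ltW.
pose s := nnsfun_approx measurableT mh.
apply: (@approximable_lim _ _ (fun n x => s n (tup x) * gaussian x) _ f) => //; last 2 first.
- move=> n x; rewrite normrM (gtr0_norm (g0 x)) (ger0_norm (f0 x)) -ler_pdivlMr//.
  have -> : f x / gaussian x = fine (h (tup x)) by rewrite /h /= row_of_tupleK.
  rewrite ger0_norm ?fun_ge0// -lee_fin fineK// /s nnsfun_approxE.
  exact: le_approx.
- move=> x; have -> : f x = (f x / gaussian x) * gaussian x by rewrite divfK// gt_eqF.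
  apply: cvgM; last exact: cvg_cst.
  have := @cvg_nnsfun_approx _ _ _ _ measurableT _ mh h0 (tup x) Logic.I.
  by rewrite /h row_of_tupleK => /fine_cvg.
move=> n; have dg : approximable (@gaussian R N) by rewrite -hermfun0;
  apply: approximable_hermspan; exact: hermspan_hermfun.
suff : multiplier (fun x => s n (tup x)) by exact.
pose S : seq R := finmap.enum_fset (fset_set (range (s n))).
have H : multiplier (fun x => \sum_(i < size S) (S`_i * \1_(s n @^-1` [set S`_i]) (tup x))).
  apply: multiplier_sum => k; apply: multiplierM; first exact: multiplier_cst.
  by apply: (measurable_multiplier_set _).2.
by move: H; congr multiplier; apply/funext => x; rewrite [RHS]fimfunEord.
exact: lf.1.
Qed.

Lemma approximable_L2 f : L2 f -> approximable f.
Proof.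
move=> lf.
have lp : L2 (fun x => Num.max (f x) 0).
  apply: (le_L2 _ lf); first by apply: measurable_maxr => //; exact: lf.1.
  by move=> x; case: (lerP (f x) 0) => // h; rewrite normr0.
have lm : L2 (fun x => Num.max (- f x) 0).
  apply: (le_L2 _ lf); first by apply: measurable_maxr => //; exact: (L2N lf).1.
  by move=> x; case: (lerP (- f x) 0) => // h; rewrite ?normr0 ?normrN.
have dp := approximable_ge0 lp (fun x => ltac:(by rewrite le_max lexx orbT)).
have dm := approximable_ge0 lm (fun x => ltac:(by rewrite le_max lexx orbT)).
have := approximableD dp (approximableZ (-1) dm); congr approximable; apply/funext => x.
by case: (lerP (f x) 0) => h; case: (lerP (- f x) 0) => h'; lra.
Qed.

End DensityL2.

(** * The spectral gap *)

Section SpectralGap.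
Context {R : realType} {N : nat}.
Notation F := ('rV[R]_N -> R).
Notation idx := {ffun 'I_N -> nat}.
Notation hermfun := (@hermfun R N).
Notation hnorm := (@hnorm R N).
Notation idx0 := ([ffun=> 0%N] : idx).
Implicit Types (f g p : F) (x : 'rV[R]_N) (a b : idx) (i j : 'I_N).

(** Parseval's identity in finite form: finitely many coefficients account for the squared norm up
    to [e]. Density supplies some combination, and the orthogonal projection onto the same Hermite
    functions is at least as close. *)
Lemma L2_approx f (e : R) : L2 f -> 0 < e -> exists s : seq idx, uniq s /\
  ip f f - \sum_(a <- s) ip f (hermfun a) ^+ 2 / hnorm a < e.
Proof.
move=> lf e0; have [_ /(_ _ e0)[p [s ->] hs]] := approximable_L2 lf.
pose u := undup [seq q.2 | q <- s]; exists u; split; first exact: undup_uniq.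
(* Gathers the coefficients of repeated multi-indices, since best approximation needs distinct
   ones. *)
pose c a := \sum_(q <- s | q.2 == a) q.1.
apply: le_lt_trans hs.
have -> : (fun x => f x - \sum_(q <- s) q.1 * hermfun q.2 x) =
          (fun x => f x - \sum_(a <- u) c a * hermfun a x).
  apply/funext => x; congr (_ - _).
  rewrite big_seq (eq_bigr (fun q => \sum_(a <- u | q.2 == a) q.1 * hermfun a x)); last first.
    move=> q qs; rewrite -big_filter.
    have -> : [seq a <- u | q.2 == a] = [:: q.2].
      rewrite (eq_filter (a2 := pred1 q.2)); last by move=> a; rewrite /= eq_sym.
      apply: perm_small_eq => //; apply: uniq_perm => //.
        by rewrite filter_uniq ?undup_uniq.
      move=> a; rewrite mem_filter inE /= mem_undup; case: eqVneq => //= ->.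
      by rewrite map_f.
    by rewrite big_seq1.
  rewrite -big_seq (exchange_big_dep xpredT)//=.
  by apply: eq_bigr => a _; rewrite /c mulr_suml.
apply: best_approximation => //; [exact: (@L2_hermfun R N)|exact: hnorm_gt0|exact: undup_uniq|].
exact: ip_hermfun.
Qed.

(** The modes at which (d_i + x_i) f has to be tested in order to see the modes of f listed in
    [s]. *)
Definition lower (s : seq idx) i := [seq dec a i | a <- s & (0 < a i)%N].

Lemma lower_uniq s i : uniq s -> uniq (lower s i).
Proof.
move=> us; rewrite map_inj_in_uniq ?filter_uniq// => a b.
by rewrite !mem_filter => /andP[a0 _] /andP[b0 _] ab; rewrite -(decK a0) ab decK.
Qed.

(** The degree is the sum of the a_i, and a_i / |h_a|^2 = 2 / |h_{a - e_i}|^2. *)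
Lemma sum_deg (w : idx -> R) s :
  \sum_(a <- s) (deg a)%:R * (w a / hnorm a) =
  \sum_i \sum_(b <- lower s i) 2 * w (inc b i) / hnorm b.
Proof.
rewrite (eq_bigr (fun a => \sum_i (a i)%:R * (w a / hnorm a))); last first.
  by move=> a _; rewrite -mulr_suml natr_sum.
rewrite exchange_big; apply: eq_bigr => i _.
rewrite big_map big_filter [RHS]big_mkcond; apply: eq_bigr => a _.
case: posnP => [->|ai]; first by rewrite mul0r.
rewrite decK// -[in LHS](decK ai) hnorm_inc decK// ffunE eqxx subn1 prednK//.
have h0 := lt0r_neq0 (hnorm_gt0 (R := R) (dec a i)).
have a0 : (a i)%:R != 0 :> R by rewrite pnatr_eq0 -lt0n.
by field; rewrite h0 a0.
Qed.

Lemma sum_deg0_le (c : idx -> R) s : uniq s ->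
  \sum_(a <- s) (deg a == 0)%:R * c a ^+ 2 / hnorm a <= c idx0 ^+ 2 / @gauss_mass R N.
Proof.
move=> us.
have h0 : hnorm idx0 = @gauss_mass R N.
  by rewrite /hnorm big1 ?mulr1// => k _; rewrite ffunE expr0 divr1.
have d0 : deg idx0 = 0%N by rewrite /deg big1// => k _; rewrite ffunE.
have z a : a != idx0 -> (deg a == 0)%:R * c a ^+ 2 / hnorm a = 0.
  move=> a0; case: (deg a =P 0%N) => [/deg_eq0 h|_]; last by rewrite !mul0r.
  by rewrite h eqxx in a0.
have [s0|s0] := boolP (idx0 \in s).
  by rewrite (bigD1_seq idx0)//= big1 ?addr0 ?d0 ?mul1r ?h0// => a /z.
rewrite big_seq big1; last by move=> a sa; apply: z; apply: contraNneq s0 => <-.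
by rewrite divr_ge0 ?sqr_ge0// ltW// gauss_mass_gt0.
Qed.

(** This is [sum_deg] for weights cut down to degree k + 1, where the factor [deg a] is constant.
    Iterated, it turns the sums over modes of degree 1 and 2 into sums over indices and over ordered
    pairs with the same coefficient 2 / Z, so no multiplicities are counted. *)
Lemma sum_degS (c : idx -> R) s k : uniq s ->
  k.+1%:R * \sum_(a <- s) (deg a == k.+1)%:R * c a ^+ 2 / hnorm a =
  2 * \sum_i \sum_(b <- lower s i) (deg b == k)%:R * c (inc b i) ^+ 2 / hnorm b.
Proof.
move=> us; have := sum_deg (fun a => (deg a == k.+1)%:R * c a ^+ 2) s.
rewrite mulr_sumr (eq_bigr (fun a => k.+1%:R * ((deg a == k.+1)%:R * c a ^+ 2 / hnorm a))).
  move=> ->; rewrite mulr_sumr; apply: eq_bigr => i _; rewrite mulr_sumr.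
  by apply: eq_bigr => b _; rewrite deg_inc eqSS !mulrA.
by move=> a _; case: eqP => [->//|_]; rewrite !mul0r !mulr0.
Qed.

Lemma sum_deg1_le (c : idx -> R) s : uniq s ->
  \sum_(a <- s) (deg a == 1)%:R * c a ^+ 2 / hnorm a <=
  2 / @gauss_mass R N * \sum_i c (inc idx0 i) ^+ 2.
Proof.
move=> us; have := sum_degS c 0 us; rewrite mul1r => ->.
rewrite -mulrA ler_pM2l// mulr_sumr; apply: ler_sum => i _.
rewrite mulrC; exact: (sum_deg0_le (fun b => c (inc b i)) (lower_uniq i us)).
Qed.

Lemma sum_deg2_le (c : idx -> R) s : uniq s ->
  \sum_(a <- s) (deg a == 2)%:R * c a ^+ 2 / hnorm a <=
  2 / @gauss_mass R N * \sum_i \sum_j c (inc (inc idx0 j) i) ^+ 2.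
Proof.
move=> us; have := sum_degS c 1 us => /mulfI -> //.
rewrite mulr_sumr; apply: ler_sum => i _.
exact: (sum_deg1_le (fun b => c (inc b i)) (lower_uniq i us)).
Qed.

(* The weights come from 2 k >= 2 ([k >= 1] + [k >= 2] + [k >= 3]), k being the degree. *)
Lemma spectral_gap f (g : 'I_N -> F) : L2 f -> (forall i, L2 (g i)) ->
  (forall i a, ip (g i) (hermfun a) = 2 * ip f (hermfun (inc a i))) ->
  6 * ip f f - 6 * (ip f (hermfun idx0) ^+ 2 / @gauss_mass R N)
  - 4 * (2 / @gauss_mass R N * \sum_i ip f (hermfun (inc idx0 i)) ^+ 2)
  - 2 * (2 / @gauss_mass R N * \sum_i \sum_j ip f (hermfun (inc (inc idx0 j) i)) ^+ 2)
  <= \sum_i ip (g i) (g i).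
Proof.
move=> lf lg fg; pose c a := ip f (hermfun a); pose q a := c a ^+ 2 / hnorm a.
apply/ler_addgt0Pr => e e0; have e6 : 0 < e / 6 by rewrite divr_gt0.
have [s [us hs]] := L2_approx lf e6.
(* Bessel's inequality for each [g i] on the lowered list. *)
have h1 : 2 * \sum_(a <- s) (deg a)%:R * q a <= \sum_i ip (g i) (g i).
  have := sum_deg (fun a => c a ^+ 2) s; rewrite /q => ->.
  rewrite mulr_sumr; apply: ler_sum => i _.
  apply: le_trans (bessel (@L2_hermfun R N) (@hnorm_gt0 R N) (lower_uniq i us) (@ip_hermfun
    R N) (lg i)).
  rewrite mulr_sumr le_eqVlt; apply/orP; left; apply/eqP; apply: eq_bigr => b _.
  by rewrite fg -/(c (inc b i)); ring.
have q0 a : 0 <= q a by rewrite divr_ge0 ?sqr_ge0// ltW// hnorm_gt0.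
have h2 : 6 * \sum_(a <- s) q a
   - 6 * \sum_(a <- s) (deg a == 0)%:R * c a ^+ 2 / hnorm a
   - 4 * \sum_(a <- s) (deg a == 1)%:R * c a ^+ 2 / hnorm a
   - 2 * \sum_(a <- s) (deg a == 2)%:R * c a ^+ 2 / hnorm a
   <= 2 * \sum_(a <- s) (deg a)%:R * q a.
  rewrite !mulr_sumr -!sumrB; apply: ler_sum => a _.
  rewrite -!(mulrA (_ == _)%:R) -/(q a).
  case: (deg a) => [|[|[|n]]] /=; have := q0 a; rewrite ?mul0r ?mulr0 ?mul1r ?subr0; try lra.
  move=> qa; have : 0 <= n%:R * q a by rewrite mulr_ge0.
  by rewrite -[n.+3]addn3 natrD; lra.
have h3 := sum_deg0_le c us; have h4 := sum_deg1_le c us; have h5 := sum_deg2_le c us.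
rewrite -/c in hs *; move: hs h2 h3 h4 h5; rewrite -/(c _).
rewrite /q.
lra.
Qed.

End SpectralGap.

(** * Toroidal fields *)

Section WeakFields.
Context {R : realType} {N : nat}.
Notation F := ('rV[R]_N -> R).
Notation idx := {ffun 'I_N -> nat}.
Notation hermfun := (@hermfun R N).
Implicit Types (f g : F) (x : 'rV[R]_N) (a b : idx) (i j : 'I_N).
Implicit Types (U : 'rV[R]_N -> 'rV[R]_N) (G : 'rV[R]_N -> 'M[R]_N).

Definition ucomp U j : F := fun x => U x 0 j.
Definition xcomp U i j : F := fun x => x 0 i * U x 0 j.
Definition gcomp G i j : F := fun x => G x i j.

Definition L2_field U G := [/\ forall j, L2 (ucomp U j), forall i j, L2 (xcomp U i j)
  & forall i j, L2 (gcomp G i j)].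

Lemma integralN_sum_sqr (I : Type) (s : seq I) (f : I -> F) : (forall k, L2 (f k)) ->
  integrableN (fun x => \sum_(k <- s) f k x ^+ 2) /\
  integralN (fun x => \sum_(k <- s) f k x ^+ 2) = (\sum_(k <- s) ip (f k) (f k))%:E.
Proof.
move=> lf; elim: s => [|k s [IH1 IH2]].
  have E : (fun x : 'rV[R]_N => \sum_(k <- [::]) f k x ^+ 2) = fun=> 0.
    by apply/funext => x; rewrite big_nil.
  rewrite E big_nil; split.
    have := L2_sqr (@L2_0 R N); congr integrableN; apply/funext => x; by rewrite expr0n.
  by rewrite /integralN integral0.
have E : (fun x : 'rV[R]_N => \sum_(k <- k :: s) f k x ^+ 2) =
    fun x => f k x ^+ 2 + \sum_(k <- s) f k x ^+ 2.
  by apply/funext => x; rewrite big_cons.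
have lk := L2_sqr (lf k).
rewrite E big_cons; split; first exact: integrableND.
by rewrite integralND// IH2 integralN_sqr.
Qed.

Definition gnorm G : R := \sum_i \sum_j ip (gcomp G i j) (gcomp G i j).
Definition xnorm U : R := \sum_i \sum_j ip (xcomp U i j) (xcomp U i j).
Definition unorm U : R := \sum_j ip (ucomp U j) (ucomp U j).

Lemma integralN_sqnorm_mx G : (forall i j, L2 (gcomp G i j)) ->
  integralN (fun x => sqnorm (G x)) = (gnorm G)%:E.
Proof.
move=> lG; have [_] := integralN_sum_sqr (index_enum ('I_N * 'I_N)%type) (fun p => lG p.1 p.2).
rewrite -(pair_bigA _ (fun i j => ip (gcomp G i j) (gcomp G i j))) => <-.
by congr integralN; apply/funext => x; rewrite /sqnorm (pair_bigA _ (fun i j => G x i j ^+ 2)).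
Qed.

Lemma integralN_sqnormM U : (forall i j, L2 (xcomp U i j)) ->
  integralN (fun x => sqnorm (U x) * sqnorm x) = (xnorm U)%:E.
Proof.
move=> lU; have [_] := integralN_sum_sqr (index_enum ('I_N * 'I_N)%type) (fun p => lU p.1 p.2).
rewrite -(pair_bigA _ (fun i j => ip (xcomp U i j) (xcomp U i j))) => <-.
congr integralN; apply/funext => x; rewrite -(pair_bigA _ (fun i j => xcomp U i j x ^+ 2)).
rewrite !sqnorm_row mulrC mulr_suml; apply: eq_bigr => i _.
by rewrite mulr_sumr; apply: eq_bigr => j _; rewrite exprMn.
Qed.

Lemma integralN_sqnorm_row U : (forall j, L2 (ucomp U j)) ->
  integralN (fun x => sqnorm (U x)) = (unorm U)%:E.
Proof.
move=> lU; have [_] := integralN_sum_sqr (index_enum 'I_N) lU.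
by move=> <-; congr integralN; apply/funext => x; rewrite sqnorm_row.
Qed.

Lemma energyE U G : L2_field U G -> energy U G = (gnorm G + xnorm U + unorm U)%:E.
Proof.
by move=> [lu lx lg]; rewrite /energy integralN_sqnorm_mx// integralN_sqnormM//
  integralN_sqnorm_row.
Qed.

Lemma le_sqnorm m n (M : 'M[R]_(m, n)) (i : 'I_m) (j : 'I_n) : M i j ^+ 2 <= sqnorm M.
Proof.
rewrite /sqnorm (bigD1 i)//= (bigD1 j)//= -addrA lerDl addr_ge0 ?sumr_ge0// => k _.
  exact: sqr_ge0.
by rewrite sumr_ge0// => l _; exact: sqr_ge0.
Qed.

Lemma sqnorm_mx_ge0 m n (M : 'M[R]_(m, n)) : 0 <= sqnorm M.
Proof. by rewrite sumr_ge0// => i _; rewrite sumr_ge0// => j _; exact: sqr_ge0. Qed.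

Lemma integralN_ge0 f : (forall x, 0 <= f x) -> (0 <= integralN f)%E.
Proof. by move=> f0; apply: integral_ge0 => t _; rewrite lee_fin. Qed.

Lemma L2_dominated f g : measurableN f -> measurableN g -> (forall x, f x ^+ 2 <= g x) ->
  (integralN g < +oo)%E -> L2 f.
Proof.
move=> mf mg fg gi; apply: integrableN_L2 => //.
apply: (@le_integrableN _ _ _ g); first exact: measurable_funX.
  by apply: ge0_integrableN => // x; apply: le_trans (fg x); exact: sqr_ge0.
by move=> x; rewrite ger0_norm ?sqr_ge0.
Qed.

Lemma energy_L2 U G : (forall j, measurableN (ucomp U j)) ->
  (forall i j, measurableN (gcomp G i j)) -> (energy U G < +oo)%E -> L2_field U G.
Proof.
move=> mU mG; rewrite /energy => eU.
have mu : measurableN (fun x => sqnorm (U x)).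
  have : measurableN (fun x => \sum_j ucomp U j x ^+ 2).
    by apply: measurable_sum => j; apply: measurable_funX; exact: mU.
  by congr measurableN; apply/funext => x; rewrite sqnorm_row.
have mg : measurableN (fun x => sqnorm (G x)).
  have : measurableN (fun x => \sum_i \sum_j gcomp G i j x ^+ 2).
    by do 2 apply: measurable_sum => ?; apply: measurable_funX; exact: mG.
  by [].
have ge1 := integralN_ge0 (fun x => sqnorm_mx_ge0 (G x)).
have ge2 : (0 <= integralN (fun x => (sqnorm (U x) * sqnorm x)%R))%E.
  by apply: integralN_ge0 => x; rewrite mulr_ge0 ?sqnorm_mx_ge0.
have ge3 := integralN_ge0 (fun x => sqnorm_mx_ge0 (U x)).
have f1 : (integralN (fun x => sqnorm (G x)) < +oo)%E.
  by apply: le_lt_trans eU; rewrite -addeA leeDl// adde_ge0.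
have f2 : (integralN (fun x => (sqnorm (U x) * sqnorm x)%R) < +oo)%E.
  by apply: le_lt_trans eU; rewrite addeAC leeDr// adde_ge0.
have f3 : (integralN (fun x => sqnorm (U x)) < +oo)%E.
  by apply: le_lt_trans eU; rewrite leeDr// adde_ge0.
split.
- by move=> j; apply: (L2_dominated (mU j) mu _ f3) => x; exact: le_sqnorm.
- move=> i j; apply: (L2_dominated _ _ _ f2).
  + by apply: measurable_funM; [exact: measurable_coord|exact: mU].
  + by apply: measurable_funM => //; exact: measurable_sqnorm.
  + move=> x; rewrite exprMn mulrC; apply: ler_pM; rewrite ?sqr_ge0//; exact: le_sqnorm.
- by move=> i j; apply: (L2_dominated (mG i j) mg _ f1) => x; exact: le_sqnorm.
Qed.

(* The identities satisfied by smooth toroidal fields that survive passage to the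
   limit: integration by parts against the Hermite functions, orthogonality to
   gradients and to radial fields, and the virial identity. *)
Definition weak_field U G := [/\ L2_field U G,
  forall i j a, ip (gcomp G i j) (hermfun a) + ip (xcomp U i j) (hermfun a) - 2 * ip (ucomp
    U j) (hermfun (inc a i)) = 0,
  forall a, \sum_i ip (ucomp U i) (partial i (hermfun a)) = 0,
  forall a, \sum_i ip (xcomp U i i) (hermfun a) = 0 &
  forall j, \sum_i 2 * ip (gcomp G i j) (xcomp U i j) + N%:R * ip (ucomp U j) (ucomp U j) = 0].

Lemma C1_coord i j : C1_along i (fun x : 'rV[R]_N => x 0 j) /\
  partial i (fun x : 'rV[R]_N => x 0 j) = fun=> (i == j)%:R.
Proof.
have E : partial i (fun x : 'rV[R]_N => x 0 j) = fun=> (i == j)%:R.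
  by apply/funext => x; have [_ <-] := is_derive_coord x i j.
split=> //; split; first exact: continuous_coord.
  by move=> x; have [] := is_derive_coord x i j.
by rewrite E; exact: cst_continuous.
Qed.

Lemma smooth_weak_field U : smooth_toroidal U -> weak_field U (grad U).
Proof.
move=> [sU [tU dU] eU].
have gE i j : gcomp (grad U) i j = partial i (ucomp U j).
  by apply/funext => x; rewrite /gcomp mxE.
have cU i j : C1_along i (ucomp U j).
  have [c0 d0] := sU j [::]; have [c1 _] := sU j [:: i].
  by split => // x; exact: d0.
have lf : L2_field U (grad U).
  apply: energy_L2 => //.
    by move=> j; apply: continuous_measurableN; have [] := sU j [::].
  by move=> i j; rewrite gE; apply: continuous_measurableN; have [] := cU i j.
have [lu lx lg] := lf.
have L a := @L2_hermfun R N a.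
have lgp i j : L2 (partial i (ucomp U j)) by rewrite -gE.
have ibp i j a : ip (gcomp (grad U) i j) (hermfun a) + ip (ucomp U j) (partial i (hermfun
  a)) = 0.
  rewrite gE; apply: integration_by_parts_along => //;
    [exact: C1_hermfun|exact: L2_partial_hermfun].
have xE i j a : ip (xcomp U i j) (hermfun a) = ip (ucomp U j) (fun x => hermfun (inc a i) x
  + (a i)%:R / 2 * hermfun (dec a i) x).
  congr (fine (integralN _)); apply/funext => x.
  by rewrite -hermfun_mulx /xcomp /ucomp; ring.
have LZ c a := L2Z c (L a).
split => //.
- move=> i j a; have := ibp i j a; rewrite xE partial_hermfun ipBr// ipDr// !ipZr// => h; lra.
- move=> a.
  (* Moving the derivatives onto the field produces its divergence. *)
  have -> : \sum_i ip (ucomp U i) (partial i (hermfun a)) = - \sum_i ip (gcomp (grad U) i i)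
    (hermfun a).
    by rewrite -sumrN; apply: eq_bigr => i _; have := ibp i i a; lra.
  rewrite -ip_suml//; apply/eqP; rewrite oppr_eq0; apply/eqP.
  rewrite -[RHS](ip0l (hermfun a)); congr ip; apply/funext => x.
  by rewrite -[RHS](dU x); apply: eq_bigr => i _; rewrite gE.
- move=> a; rewrite -ip_suml// -[RHS](ip0l (hermfun a)); congr ip; apply/funext => x.
  by rewrite -[RHS](tU x); apply: eq_bigr => i _; rewrite /xcomp mulrC.
- move=> j.
  (* The vanishing integral of d_i (x_i u^2), with u the j-th component. The integrand 2 x_i u d_i u
     + u^2 is integrable because u, x_i u and d_i u are in L^2. *)
  have h i : 2 * ip (gcomp (grad U) i j) (xcomp U i j) + ip (ucomp U j) (ucomp U j) = 0.
    have [cc ce] := C1_coord i i.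
    have [c1 e1] := C1_alongM cc (cU i j).
    have [[k1 k2 k3] e2] := C1_alongM c1 (cU i j).
    have i1 : integrableN (fun x => x 0 i * ucomp U j x * ucomp U j x) by exact: L2M (lx i
      j) (lu j).
    have i2 := L2M (lx i j) (lg i j); have i3 := L2M (lu j) (lu j).
    have E : partial i (fun x => x 0 i * ucomp U j x * ucomp U j x) =
        fun x => 2 * (xcomp U i j x * gcomp (grad U) i j x) + ucomp U j x * ucomp U j x.
      by rewrite e2 e1 ce -gE; apply/funext => x; rewrite eqxx /xcomp /ucomp /=; ring.
    have := integralN_partial k1 k2 k3 i1; rewrite E.
    move=> /(_ (integrableND (integrableNZ 2 i2) i3)).
    rewrite integralND//; last exact: integrableNZ.
    by rewrite integralNZ// !ipE// -EFinM -EFinD => -[]; rewrite ipC.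
  rewrite (_ : N%:R * _ = \sum_(i < N) ip (ucomp U j) (ucomp U j)); last first.
    by rewrite sumr_const card_ord mulr_natl.
  by rewrite -big_split /= big1.
Qed.

Lemma cvg_sumR (I : Type) (s : seq I) (u : I -> nat -> R) (l : I -> R) :
  (forall k, u k n @[n --> \oo] --> l k) ->
  \sum_(k <- s) u k n @[n --> \oo] --> \sum_(k <- s) l k.
Proof.
move=> ul; elim: s => [|k s IH].
  by rewrite big_nil (_ : (fun n => _) = fun=> 0); [exact: cvg_cst|apply/funext => n;
    rewrite big_nil].
rewrite big_cons (_ : (fun n => _) = fun n => u k n + \sum_(k <- s) u k n); first exact: cvgD.
by apply/funext => n; rewrite big_cons.
Qed.

Lemma cvg_const0 (u : nat -> R) (l : R) : (forall n,
  u n = 0) -> u n @[n --> \oo] --> l -> l = 0.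
Proof.
move=> u0; rewrite (funext u0) => h.
exact: (cvg_unique _ h (cvg_cst 0)).
Qed.

(** Each identity in [weak_field] is a finite combination of inner products involving [U], x [U] and
    [G], hence continuous for the energy. *)
Lemma completion_weak_field U G : toroidal_completion U G -> weak_field U G.
Proof.
move=> [mU mG [V sV /fine_cvgP[fV cV]]].
(* The energies of the differences are known to be finite only from some rank on, hence the shift by
   [K]. *)
have [K _ hK] := fV.
pose W k := V (k + K)%N.
have wW k : weak_field (W k) (grad (W k)) by exact: smooth_weak_field (sV _).
have mW k j : measurableN (ucomp (W k) j) by have [[h _ _] _ _ _ _] := wW k; exact: (h j).1.
have mgW k i j : measurableN (gcomp (grad (W k)) i j).
  by have [[_ _ h] _ _ _ _] := wW k; exact: (h i j).1.
pose dW k x := W k x - U x; pose dG k x := grad (W k) x - G x.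
have lD k : L2_field (dW k) (dG k).
  apply: energy_L2.
  - move=> j; have := measurable_funB (mW k j) (mU j).
    by congr (measurable_fun _ _); apply/funext => t; rewrite /= /ucomp /dW !mxE.
  - move=> i j; have := measurable_funB (mgW k i j) (mG i j).
    by congr (measurable_fun _ _); apply/funext => t; rewrite /= /gcomp /dG !mxE.
  - by rewrite ltey_eq; apply/orP; left; apply: hK; rewrite /= leq_addl.
have cE : gnorm (dG k) + xnorm (dW k) + unorm (dW k) @[k --> \oo] --> 0.
  have := cV; rewrite -(cvg_shiftn K).
  rewrite (_ : [sequence _]_n = (fun k => gnorm (dG k) + xnorm (dW k) + unorm (dW k)))//.
  by apply/funext => k; have := congr1 fine (energyE (lD k)).
have g0 k i j : 0 <= ip (gcomp (dG k) i j) (gcomp (dG k) i j) by exact: ip_ge0.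
have x0 k i j : 0 <= ip (xcomp (dW k) i j) (xcomp (dW k) i j) by exact: ip_ge0.
have u0 k j : 0 <= ip (ucomp (dW k) j) (ucomp (dW k) j) by exact: ip_ge0.
have sg0 k : 0 <= gnorm (dG k) by rewrite !sumr_ge0// => i _; rewrite sumr_ge0.
have sx0 k : 0 <= xnorm (dW k) by rewrite !sumr_ge0// => i _; rewrite sumr_ge0.
have su0 k : 0 <= unorm (dW k) by rewrite sumr_ge0.
have small (v : nat -> R) : (forall k, 0 <= v k <= gnorm (dG k) + xnorm (dW k) + unorm (dW
  k)) ->
    v k @[k --> \oo] --> 0.
  move=> hv; apply: (squeeze_cvgr _ (@cvg_cst _ 0 _ _ _) cE).
  by near=> k; exact: hv.
have le1 (I : finType) (E : I -> R) (k : I) : (forall k, 0 <= E k) -> E k <= \sum_k E k.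
  by move=> E0; rewrite (bigD1 k)//= lerDl sumr_ge0.
have le2 (E : 'I_N -> 'I_N -> R) i j : (forall i j, 0 <= E i j) -> E i j <= \sum_i \sum_j E i j.
  move=> E0; apply: le_trans (le1 _ (E i) j (E0 i)) _.
  by apply: (le1 _ (fun i => \sum_j E i j)) => k; rewrite sumr_ge0.
have cg i j : ip (gcomp (dG k) i j) (gcomp (dG k) i j) @[k --> \oo] --> 0.
  apply: small => k; rewrite g0 /=.
  have := le2 _ i j (g0 k); have := sx0 k; have := su0 k.
  by rewrite /gnorm; lra.
have cx i j : ip (xcomp (dW k) i j) (xcomp (dW k) i j) @[k --> \oo] --> 0.
  apply: small => k; rewrite x0 /=.
  have := le2 _ i j (x0 k); have := sg0 k; have := su0 k.
  by rewrite /xnorm; lra.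
have cu j : ip (ucomp (dW k) j) (ucomp (dW k) j) @[k --> \oo] --> 0.
  apply: small => k; rewrite u0 /=.
  by have := le1 _ _ j (u0 k); have := sg0 k; have := sx0 k; rewrite /unorm; lra.
have lWu k j : L2 (ucomp (W k) j) by have [[]] := wW k.
have lWx k i j : L2 (xcomp (W k) i j) by have [[]] := wW k.
have lWg k i j : L2 (gcomp (grad (W k)) i j) by have [[]] := wW k.
have uE k j : ucomp (dW k) j = fun x => ucomp (W k) j x - ucomp U j x.
  by apply/funext => x; rewrite /ucomp /dW !mxE.
have xE k i j : xcomp (dW k) i j = fun x => xcomp (W k) i j x - xcomp U i j x.
  by apply/funext => x; rewrite /xcomp /dW !mxE; ring.
have gE k i j : gcomp (dG k) i j = fun x => gcomp (grad (W k)) i j x - gcomp G i j x.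
  by apply/funext => x; rewrite /gcomp /dG !mxE.
(* The limit is in L^2 as one approximant minus its difference with the limit. *)
have lim_diff (f g h : F) : L2 f -> L2 h -> h = (fun x => f x - g x) -> L2 g.
  move=> lf lh hE; have := L2B lf lh; congr L2; apply/funext => x.
  by rewrite hE; ring.
have lu j : L2 (ucomp U j) by have [h _ _] := lD 0%N;
  exact: lim_diff (lWu 0%N j) (h j) (uE 0%N j).
have lx i j : L2 (xcomp U i j) by have [_ h _] := lD 0%N;
  exact: lim_diff (lWx 0%N i j) (h i j) (xE 0%N i j).
have lg i j : L2 (gcomp G i j) by have [_ _ h] := lD 0%N;
  exact: lim_diff (lWg 0%N i j) (h i j) (gE 0%N i j).
have {}cu j : ip (fun x => ucomp (W k) j x - ucomp U j x) (fun x => ucomp (W k) j x - ucomp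
  U j x) @[k --> \oo] --> 0.
  by have := cu j; under eq_fun do rewrite uE.
have {}cx i j : ip (fun x => xcomp (W k) i j x - xcomp U i j x) (fun x => xcomp (W k) i j x
  - xcomp U i j x) @[k --> \oo] --> 0.
  by have := cx i j; under eq_fun do rewrite xE.
have {}cg i j : ip (fun x => gcomp (grad (W k)) i j x - gcomp G i j x) (fun x => gcomp (grad
  (W k)) i j x - gcomp G i j x) @[k --> \oo] --> 0.
  by have := cg i j; under eq_fun do rewrite gE.
have ccst f : L2 f -> ip (fun x => f x - f x) (fun x => f x - f x) @[k --> \oo] --> 0.
  move=> lf; rewrite (_ : (fun x => f x - f x) = fun=> 0) ?ip0l; first exact: cvg_cst.
  by apply/funext => x; rewrite subrr.
have L a := @L2_hermfun R N a; have LD i a := @L2_partial_hermfun R N i a.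
have cuf j f : L2 f -> ip (ucomp (W k) j) f @[k --> \oo] --> ip (ucomp U j) f.
  by move=> lf; apply: (cvg_ip (lWu^~ j) (fun=> lf)) => //; exact: ccst.
have cxf i j f : L2 f -> ip (xcomp (W k) i j) f @[k --> \oo] --> ip (xcomp U i j) f.
  by move=> lf; apply: (cvg_ip (fun k => lWx k i j) (fun=> lf)) => //; exact: ccst.
have cgf i j f : L2 f -> ip (gcomp (grad (W k)) i j) f @[k --> \oo] --> ip (gcomp G i j) f.
  by move=> lf; apply: (cvg_ip (fun k => lWg k i j) (fun=> lf)) => //; exact: ccst.
split=> //.
- move=> i j a; have w k : ip (gcomp (grad (W k)) i j) (hermfun a) + ip (xcomp (W k) i j)
  (hermfun a)
      - 2 * ip (ucomp (W k) j) (hermfun (inc a i)) = 0 by have [_ ->] := wW k.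
  apply: (cvg_const0 w); apply: cvgB; first by apply: cvgD; [exact: cgf|exact: cxf].
  by apply: cvgM; [exact: cvg_cst|exact: cuf].
- move=> a; have w k : \sum_i ip (ucomp (W k) i) (partial i (hermfun a)) = 0 by have [_ _
  ->] := wW k.
  by apply: (cvg_const0 w); apply: cvg_sumR => i; exact: cuf.
- move=> a; have w k : \sum_i ip (xcomp (W k) i i) (hermfun a) = 0 by have [_ _ _ ->] := wW k.
  by apply: (cvg_const0 w); apply: cvg_sumR => i; exact: cxf.
- move=> j; have w k : \sum_i 2 * ip (gcomp (grad (W k)) i j) (xcomp (W k) i j)
      + N%:R * ip (ucomp (W k) j) (ucomp (W k) j) = 0 by have [_ _ _ _ ->] := wW k.
  apply: (cvg_const0 w); apply: cvgD.
    apply: cvg_sumR => i; apply: cvgM; first exact: cvg_cst.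
    by apply: cvg_ip.
  by apply: cvgM; [exact: cvg_cst|apply: cvg_ip].
Unshelve. all: by end_near.
Qed.


End WeakFields.

(** * Components of degree 0, 1 and 2 *)

Section LowModes.
Context {R : realType} {N : nat}.
Notation F := ('rV[R]_N -> R).
Notation idx := {ffun 'I_N -> nat}.
Notation hermfun := (@hermfun R N).
Notation idx0 := ([ffun=> 0%N] : idx).
Notation Z := (@gauss_mass R N).
Implicit Types (f g : F) (x : 'rV[R]_N) (a b c : idx) (i j k l m : 'I_N).

Lemma incC a i j : inc (inc a i) j = inc (inc a j) i.
Proof. by apply/ffunP => k; rewrite !ffunE addnAC. Qed.

(* If [L a] is a linear functional of [hermfun a], then [lowering L a k] is its value
   at the k-th annihilation operator applied to [hermfun a]. *)
Definition lowering (L : idx -> R) a k : R := (a k)%:R * L (dec a k).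

(** The commutation relation between the k-th annihilation and the m-th creation operator, read on
    functionals. Repeated use evaluates every pairing of low degree. *)
Lemma lowering_inc L c m k :
  lowering L (inc c m) k = (k == m)%:R * L c + lowering (fun a => L (inc a m)) c k.
Proof.
rewrite /lowering !ffunE; case: eqVneq => [->|km] /=.
  rewrite incK mul1r addn1 -natr1 mulrDl mul1r addrC.
  by have [->|cm] := posnP (c m); rewrite ?mul0r// decK.
rewrite addn0 mul0r add0r; congr (_ * L _); apply/ffunP => q; rewrite !ffunE.
by case: (q =P k) => [->|_]; rewrite ?(negbTE km) ?subn0 ?addn0.
Qed.

Lemma lowering0 L k : lowering L idx0 k = 0.
Proof. by rewrite /lowering ffunE mul0r. Qed.

Lemma ip_hermfun_inc i a b : ip (hermfun (inc a i)) (hermfun b) = 2^-1 * lowering (fun c =>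
  ip (hermfun a) (hermfun c)) b i.
Proof. by rewrite ip_partial_hermfun /lowering; ring. Qed.

Lemma ip_hermfun00 : ip (hermfun idx0) (hermfun idx0) = Z.
Proof. by rewrite hermfun0. Qed.

Lemma ip_hermfun11 i j : ip (hermfun (inc idx0 i)) (hermfun (inc idx0 j)) = (i == j)%:R * (Z
  / 2).
Proof. by rewrite ip_hermfun_inc lowering_inc lowering0 ip_hermfun00; field. Qed.

Lemma ip_hermfun22 i j k l : ip (hermfun (inc (inc idx0 j) i)) (hermfun (inc (inc idx0 l) k)) =
  Z / 4 * ((i == k)%:R * (j == l)%:R + (i == l)%:R * (j == k)%:R).
Proof. by rewrite ip_hermfun_inc !lowering_inc lowering0 !ip_hermfun11; field. Qed.

Lemma ip_hermfun12 i k l : ip (hermfun (inc idx0 i)) (hermfun (inc (inc idx0 l) k)) = 0.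
Proof.
rewrite ip_hermfun; case: eqP => [h|_]; last by rewrite mul0r.
by have := congr1 (@deg N) h; rewrite !deg_inc => /eqP; rewrite ltn_eqF.
Qed.

Lemma coord_hermfun0 x i : x 0 i * gaussian x = hermfun (inc idx0 i) x.
Proof. by rewrite -hermfun0 hermfun_mulx ffunE !mul0r addr0. Qed.

Lemma gaussian_linear_field (A : 'M[R]_N) x j :
  (gaussian x *: linear_field A x) 0 j = \sum_i A j i * hermfun (inc idx0 i) x.
Proof.
by rewrite !mxE mulr_sumr; apply: eq_bigr => i _; rewrite !mxE -coord_hermfun0; ring.
Qed.

Lemma coord_hermfun1 x i l :
  x 0 i * (x 0 l * gaussian x) = hermfun (inc (inc idx0 l) i) x + (i == l)%:R / 2 * gaussian x.
Proof.
rewrite coord_hermfun0 hermfun_mulx !ffunE add0n; case: eqVneq => [->|_] /=.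
  by rewrite incK hermfun0.
by rewrite !mul0r.
Qed.

Lemma sum_delta k0 (E : 'I_N -> R) : \sum_k (k0 == k)%:R * E k = E k0.
Proof.
rewrite (bigD1 k0)//= eqxx mul1r big1 ?addr0// => k kk0.
by rewrite eq_sym (negbTE kk0) mul0r.
Qed.

Definition mode1 f i : R := ip f (hermfun (inc idx0 i)).
Definition mode2 f i l : R := ip f (hermfun (inc (inc idx0 l) i)).

(** The factor 2 / Z is the inverse of the squared norm Z / 2 in degree 1. It also serves in degree
    2, where the sum runs over ordered pairs: off the diagonal the squared norm is Z / 4, but each
    function occurs twice. *)
Definition proj1 f x : R := \sum_i 2 / Z * mode1 f i * hermfun (inc idx0 i) x.
Definition proj2 f x : R := \sum_i \sum_l 2 / Z * mode2 f i l * hermfun (inc (inc idx0 l) i) x.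

Let L a := @L2_hermfun R N a.
Let Z0 : Z != 0. Proof. by rewrite gt_eqF// gauss_mass_gt0. Qed.

Lemma L2_proj1 f : L2 (proj1 f).
Proof. by apply: L2_sum => i; exact: L2Z. Qed.

Lemma L2_proj2 f : L2 (proj2 f).
Proof. by do 2 apply: L2_sum => ?; exact: L2Z. Qed.

Lemma mode2C f i l : mode2 f i l = mode2 f l i.
Proof. by rewrite /mode2 incC. Qed.

Lemma ip_proj1_residual f : L2 f ->
  ip (fun x => f x - proj1 f x) (fun x => f x - proj1 f x) =
  ip f f - 2 / Z * \sum_i mode1 f i ^+ 2.
Proof.
move=> lf.
have hZ (i : 'I_N) : 0 < Z / 2 by rewrite divr_gt0 ?gauss_mass_gt0.
have := ip_sqr_expansion (fun i => L (inc idx0 i)) hZ (index_enum_uniq 'I_N) ip_hermfun11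
  (fun i => 2 / Z * mode1 f i) lf.
move=> ->; rewrite [X in _ + X]big1 ?addr0 => [|i _]; last first.
  by rewrite -/(mode1 f i) (_ : 2 / Z * _ - _ = 0) ?expr0n ?mulr0//; field.
by congr (_ - _); rewrite mulr_sumr; apply: eq_bigr => i _; rewrite -/(mode1 f i); field.
Qed.

Lemma ip_proj2 f g : L2 g ->
  ip g (proj2 f) = \sum_i \sum_l 2 / Z * mode2 f i l * mode2 g i l.
Proof.
have LZ (r : R) a := L2Z r (L a).
move=> lg; rewrite /proj2 ip_sumr//; last by move=> i; exact: L2_sum.
by apply: eq_bigr => i _; rewrite ip_sumr//; apply: eq_bigr => l _; rewrite ipZr.
Qed.

(** Indexed by ordered pairs, the functions of degree 2 repeat, so [ip_sqr_expansion] does not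
    apply. That [proj2] keeps the moments follows from their Gram matrix [ip_hermfun22] and the
    symmetry of [mode2]. *)
Lemma mode2_proj2 f i l : mode2 (proj2 f) i l = mode2 f i l.
Proof.
rewrite {1}/mode2 ipC ip_proj2//.
rewrite (eq_bigr (fun k => \sum_m ((i == k)%:R * ((l == m)%:R * (mode2 f k m / 2))
    + (l == k)%:R * ((i == m)%:R * (mode2 f k m / 2))))); last first.
  by move=> k _; apply: eq_bigr => m _; rewrite {2}/mode2 ip_hermfun22; field.
under eq_bigr do rewrite big_split -!mulr_sumr !sum_delta.
by rewrite big_split /= !sum_delta (mode2C f l i); field.
Qed.

Lemma ip_proj12_residual f : L2 f ->
  ip (fun x => f x - proj1 f x - proj2 f x) (fun x => f x - proj1 f x - proj2 f x) =
  ip f f - 2 / Z * \sum_i mode1 f i ^+ 2 - 2 / Z * \sum_i \sum_l mode2 f i l ^+ 2.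
Proof.
move=> lf; have l1 := L2_proj1 f; have l2 := L2_proj2 f.
have E : \sum_i \sum_l 2 / Z * mode2 f i l * mode2 f i l = 2 / Z * \sum_i \sum_l mode2 f i l
  ^+ 2.
  by rewrite mulr_sumr; apply: eq_bigr => i _; rewrite mulr_sumr; apply: eq_bigr => l _;
    rewrite expr2 mulrA.
rewrite ip_sqrB ?ip_proj1_residual//; last exact: L2B.
rewrite ipBl// !ip_proj2// E.
rewrite (_ : \sum_i \sum_l 2 / Z * mode2 f i l * mode2 (proj1 f) i l = 0); last first.
  rewrite big1// => i _; rewrite big1// => l _.
  rewrite {2}/mode2 /proj1 ip_suml ?big1 ?mulr0//; last by move=> k; exact: L2Z.
  by move=> k _; rewrite ipZl// ip_hermfun12 mulr0.
rewrite (_ : \sum_i \sum_l 2 / Z * mode2 f i l * mode2 (proj2 f) i l =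
    \sum_i \sum_l 2 / Z * mode2 f i l * mode2 f i l); last first.
  by apply: eq_bigr => i _; apply: eq_bigr => l _; rewrite mode2_proj2.
by rewrite E; ring.
Qed.

End LowModes.

(** * Moments of toroidal fields and the inequality *)

Section StabilityInequality.
Context {R : realType} {N : nat}.
Notation F := ('rV[R]_N -> R).
Notation idx := {ffun 'I_N -> nat}.
Notation hermfun := (@hermfun R N).
Notation idx0 := ([ffun=> 0%N] : idx).
Notation Z := (@gauss_mass R N).
Variables (U : 'rV[R]_N -> 'rV[R]_N) (G : 'rV[R]_N -> 'M[R]_N).
Hypothesis wUG : weak_field U G.

Let L a := @L2_hermfun R N a.
Let LZ c a := L2Z c (L a).
Let lu j : L2 (ucomp U j). Proof. by have [[]] := wUG. Qed.
Let lx i j : L2 (xcomp U i j). Proof. by have [[]] := wUG. Qed.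
Let lg i j : L2 (gcomp G i j). Proof. by have [[]] := wUG. Qed.

(** On Hermite functions d_i is half of annihilation minus the raising of a_i, and x_i is their sum.
    Adding and subtracting the orthogonality to gradients and to radial fields separates the lowered
    moments from the raised ones. *)
Lemma weak_field_moments a :
  \sum_i lowering (fun b => ip (ucomp U i) (hermfun b)) a i = 0 /\
  \sum_i ip (ucomp U i) (hermfun (inc a i)) = 0.
Proof.
have [_ _ /(_ a) h1 /(_ a) h2 _] := wUG.
have e1 : \sum_i ((a i)%:R / 2 * ip (ucomp U i) (hermfun (dec a i)) - ip (ucomp U i)
  (hermfun (inc a i))) = 0.
  rewrite -[RHS]h1; apply: eq_bigr => i _.
  by rewrite partial_hermfun ipBr// ipZr.
have e2 : \sum_i ((a i)%:R / 2 * ip (ucomp U i) (hermfun (dec a i)) + ip (ucomp U i)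
  (hermfun (inc a i))) = 0.
  rewrite -[RHS]h2; apply: eq_bigr => i _.
  rewrite -ipZr// -ipDr//; congr (fine (integralN _)); apply/funext => x.
  by rewrite addrC -hermfun_mulx /xcomp /ucomp; ring.
move: e1 e2; rewrite sumrB big_split /=.
have -> : \sum_i lowering (fun b => ip (ucomp U i) (hermfun b)) a i =
    2 * \sum_i (a i)%:R / 2 * ip (ucomp U i) (hermfun (dec a i)).
  by rewrite mulr_sumr; apply: eq_bigr => i _; rewrite /lowering; field.
by move=> e1 e2; split; lra.
Qed.

Notation m1 j := (mode1 (ucomp U j)).
Notation m2 j := (mode2 (ucomp U j)).

(** The relation between lowered moments at a = e_j. In degrees 2 and 3 the same relation gives
    antisymmetry and the cyclic identity: each index of a is removed in turn and becomes the
    component of the field. *)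
Lemma weak_field_mode0 j : ip (ucomp U j) (hermfun idx0) = 0.
Proof.
have [h _] := weak_field_moments (inc idx0 j); rewrite -[RHS]h.
rewrite (eq_bigr (fun i => (j == i)%:R * ip (ucomp U i) (hermfun idx0))) ?sum_delta// => i _.
by rewrite lowering_inc lowering0 addr0 eq_sym.
Qed.

Lemma weak_field_mode1 i j : m1 i j + m1 j i = 0.
Proof.
have [h _] := weak_field_moments (inc (inc idx0 i) j); rewrite -[RHS]h.
rewrite (eq_bigr (fun k => (j == k)%:R * m1 k i + (i == k)%:R * m1 k j)).
  by rewrite big_split /= !sum_delta addrC.
by move=> k _; rewrite !lowering_inc lowering0 addr0 ![k == _]eq_sym.
Qed.

Lemma weak_field_mode2 i j l : m2 i j l + m2 j i l + m2 l i j = 0.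
Proof.
have [h _] := weak_field_moments (inc (inc (inc idx0 i) j) l); rewrite -[RHS]h.
rewrite (eq_bigr (fun k => (l == k)%:R * m2 k j i + ((j == k)%:R * m2 k l i + (i == k)%:R *
  m2 k l j))).
  by rewrite !big_split /= !sum_delta (mode2C _ j i) (mode2C _ l i) (mode2C _ l j); ring.
by move=> k _; rewrite !lowering_inc lowering0 addr0 ![k == _]eq_sym.
Qed.

Lemma weak_field_mode2_div k : \sum_i m2 i i k = 0.
Proof. by have [_ h] := weak_field_moments (inc idx0 k). Qed.

(** A consequence of the cyclic identity at (i, i, k): summed over i, two of its terms vanish by
    [weak_field_mode2_div]. *)
Lemma weak_field_mode2_trace k : \sum_i m2 k i i = 0.
Proof.
have : \sum_i (m2 i i k + m2 i i k + m2 k i i) = 0.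
  by rewrite big1// => i _; rewrite -[RHS](weak_field_mode2 i i k).
by rewrite !big_split /= !weak_field_mode2_div !add0r.
Qed.

Definition low_A : 'M[R]_N := \matrix_(j, i) (2 / Z * m1 j i).
Definition low_B (j : 'I_N) : 'M[R]_N := \matrix_(i, l) (2 / Z * m2 j i l).

Lemma low_A_antisymmetric : antisymmetric_mx low_A.
Proof.
rewrite /antisymmetric_mx /=; apply/matrixP => i j; rewrite !mxE.
by have := weak_field_mode1 i j => h; rewrite -mulrN; congr (_ * _); lra.
Qed.

Lemma low_B_toroidal : toroidal_tensors low_B.
Proof.
split.
- by move=> k; apply/matrixP => i j; rewrite !mxE mode2C.
- move=> k; rewrite /mxtrace; under eq_bigr do rewrite mxE.
  by rewrite -mulr_sumr weak_field_mode2_trace mulr0.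
- move=> k; under eq_bigr do rewrite mxE.
  by rewrite -mulr_sumr weak_field_mode2_div mulr0.
- move=> i j l; rewrite !mxE -!mulrDr; have := weak_field_mode2 i j l => h.
  by rewrite -[RHS](mulr0 (2 / Z)) -h.
Qed.

Lemma gaussian_linear_fieldE x j :
  (gaussian x *: linear_field low_A x) 0 j = proj1 (ucomp U j) x.
Proof. by rewrite gaussian_linear_field; apply: eq_bigr => i _; rewrite mxE. Qed.

(** The function x_i x_l times the Gaussian has a part of degree 0, equal to half the Gaussian when
    i = l; these parts cancel since the matrices have trace 0. *)
Lemma gaussian_quadratic_fieldE x j :
  (gaussian x *: quadratic_field low_B x) 0 j = proj2 (ucomp U j) x.
Proof.
rewrite !mxE.
have -> : gaussian x * \sum_l (x *m low_B j) 0 l * x^T l 0 =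
   \sum_i \sum_l 2 / Z * m2 j i l * (x 0 i * (x 0 l * gaussian x)).
  rewrite exchange_big /= mulr_sumr; apply: eq_bigr => l _.
  rewrite !mxE mulr_suml mulr_sumr; apply: eq_bigr => i _; rewrite !mxE; ring.
rewrite (eq_bigr (fun i => \sum_l 2 / Z * m2 j i l * hermfun (inc (inc idx0 l) i) x
   + \sum_l (i == l)%:R * (2 / Z * m2 j i l / 2 * gaussian x))).
  rewrite big_split /= [X in _ + X](_ : _ = 0) ?addr0//.
  under eq_bigr do rewrite sum_delta.
  rewrite -mulr_suml -mulr_suml -mulr_sumr weak_field_mode2_trace; ring.
move=> i _; rewrite -big_split /=; apply: eq_bigr => l _.
rewrite coord_hermfun1; ring.
Qed.

Notation p1 := (\sum_j 2 / Z * \sum_i m1 j i ^+ 2).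
Notation p2 := (\sum_j 2 / Z * \sum_i \sum_l m2 j i l ^+ 2).

(** An upper bound for the infimum is all that is required, so one admissible matrix is enough. *)
Lemma dist_linear_le : (dist_linear U <= (unorm U - p1)%:E)%E.
Proof.
apply: ereal_inf_lbound; exists low_A; first exact: low_A_antisymmetric.
pose V x := U x - gaussian x *: linear_field low_A x.
have VE j : ucomp V j = fun x => ucomp U j x - proj1 (ucomp U j) x.
  by apply/funext => x; rewrite -gaussian_linear_fieldE /ucomp /V [LHS]mxE [in LHS]mxE.
rewrite (integralN_sqnorm_row (U := V)).
  congr EFin; rewrite /unorm -sumrB; apply: eq_bigr => j _.
  by rewrite VE ip_proj1_residual.
by move=> j; rewrite VE; apply: L2B => //; exact: L2_proj1.
Qed.

Lemma dist_quadratic_le : (dist_quadratic U <= (unorm U - p1 - p2)%:E)%E.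
Proof.
apply: ereal_inf_lbound; exists low_A; first exact: low_A_antisymmetric.
exists low_B; first exact: low_B_toroidal.
pose V x := U x - gaussian x *: (linear_field low_A x + quadratic_field low_B x).
have VE j : ucomp V j = fun x => ucomp U j x - proj1 (ucomp U j) x - proj2 (ucomp U j) x.
  apply/funext => x; rewrite -gaussian_linear_fieldE -gaussian_quadratic_fieldE /ucomp /V
    scalerDr.
  by rewrite [LHS]mxE [in LHS]mxE [X in _ + - X = _]mxE opprD addrA.
rewrite (integralN_sqnorm_row (U := V)).
  congr EFin; rewrite /unorm -!sumrB; apply: eq_bigr => j _.
  by rewrite VE ip_proj12_residual.
by move=> j; rewrite VE; apply: L2B; [apply: L2B => //; exact: L2_proj1|exact: L2_proj2].
Qed.

Lemma deficitE : deficit U G = (gnorm G + xnorm U - (N + 2)%:R * unorm U)%:E.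
Proof. by rewrite /deficit integralN_sqnorm_mx// integralN_sqnormM// integralN_sqnorm_row. Qed.

Definition annihilated i j : F := fun x => gcomp G i j x + xcomp U i j x.

Lemma L2_annihilated i j : L2 (annihilated i j).
Proof. exact: L2D. Qed.

Lemma ip_annihilated i j a :
  ip (annihilated i j) (hermfun a) = 2 * ip (ucomp U j) (hermfun (inc a i)).
Proof. by have [_ /(_ i j a) h _ _ _] := wUG; move: h; rewrite ipDl// => h; lra. Qed.

(** Expanding the squares, the cross terms amount to - N times the squared norm by the virial
    identity. *)
Lemma sum_ip_annihilated :
  \sum_j \sum_i ip (annihilated i j) (annihilated i j) = gnorm G + xnorm U - N%:R * unorm U.
Proof.
have [_ _ _ _ h4] := wUG.
rewrite /gnorm /xnorm [\sum_i \sum_j ip (gcomp _ _ _) _]exchange_big.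
rewrite [\sum_i \sum_j ip (xcomp _ _ _) _]exchange_big /= /unorm mulr_sumr.
rewrite -big_split -sumrB /=; apply: eq_bigr => j _.
have -> : \sum_(i < N) ip (annihilated i j) (annihilated i j) =
    \sum_i (ip (gcomp G i j) (gcomp G i j)
      + 2 * ip (gcomp G i j) (xcomp U i j) + ip (xcomp U i j) (xcomp U i j)).
  by apply: eq_bigr => i _; rewrite ip_sqrD.
by have := h4 j; rewrite !big_split /= => h; lra.
Qed.

(** Summed over the components, [spectral_gap] starts with 6 times the squared norm; passing from N
    to N + 2 takes off 2 of these. The remaining left-hand side is 2 (u - p1) + 2 (u - p1 - p2),
    with u the squared norm. *)
Lemma weak_field_spectral_gap :
  4 * unorm U - 4 * p1 - 2 * p2 <= gnorm G + xnorm U - (N + 2)%:R * unorm U.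
Proof.
have gap j : 6 * ip (ucomp U j) (ucomp U j) - 4 * (2 / Z * \sum_i m1 j i ^+ 2)
    - 2 * (2 / Z * \sum_i \sum_l m2 j i l ^+ 2) <= \sum_i ip (annihilated i j) (annihilated
      i j).
  have := spectral_gap (lu j) (L2_annihilated^~ j) (fun i a => ip_annihilated i j a).
  by rewrite weak_field_mode0 expr0n mul0r mulr0 subr0.
have : \sum_j (6 * ip (ucomp U j) (ucomp U j) - 4 * (2 / Z * \sum_i m1 j i ^+ 2)
    - 2 * (2 / Z * \sum_i \sum_l m2 j i l ^+ 2))
    <= \sum_j \sum_i ip (annihilated i j) (annihilated i j).
  by apply: ler_sum => j _; exact: gap.
by rewrite sum_ip_annihilated !sumrB -!mulr_sumr -/(unorm U) natrD => h; lra.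
Qed.

Lemma weak_field_stability :
  (2%:E * dist_linear U + 2%:E * dist_quadratic U <= deficit U G)%E.
Proof.
rewrite deficitE.
apply: (@le_trans _ _ (2 * (unorm U - p1) + 2 * (unorm U - p1 - p2))%:E).
  rewrite (EFinD (2 * _)) (EFinM 2 (unorm U - p1)) (EFinM 2 (unorm U - p1 - p2)).
  apply: leeD; apply: lee_wpmul2l => //.
    exact: dist_linear_le.
  exact: dist_quadratic_le.
by rewrite lee_fin; have := weak_field_spectral_gap => h; lra.
Qed.

End StabilityInequality.

(** * Sharpness *)

Section SmoothHermiteSpan.
Context {R : realType} {N : nat}.
Notation F := ('rV[R]_N -> R).
Implicit Types (f g : F) (i : 'I_N).

Lemma C1_along_cst i (c : R) : C1_along i (fun _ : 'rV[R]_N => c) /\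
  partial i (fun _ : 'rV[R]_N => c) = fun=> 0.
Proof.
have E : partial i (fun _ : 'rV[R]_N => c) = fun=> 0.
  by apply/funext => x; exact: derive_cst.
split=> //; split; first exact: cst_continuous.
  by move=> x; exact: derivable_cst.
by rewrite E; exact: cst_continuous.
Qed.

Lemma C1_alongD i f g : C1_along i f -> C1_along i g ->
  C1_along i (fun x => f x + g x) /\
  partial i (fun x => f x + g x) = fun x => partial i f x + partial i g x.
Proof.
move=> [cf df cdf] [cg dg cdg].
have E : partial i (fun x => f x + g x) = fun x => partial i f x + partial i g x.
  by apply/funext => x; rewrite /partial (deriveD (df x) (dg x)).
split; last exact: E.
split; first exact: (continuous_addf cf cg).
  by move=> x; exact: derivableD (df x) (dg x).
by rewrite E; exact: (continuous_addf cdf cdg).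
Qed.

(** Stability of the span under partial derivatives is what makes all its elements smooth. *)
Lemma hermspan_partial i f : hermspan f -> C1_along i f /\ hermspan (partial i f).
Proof.
move=> [s ->]; elim: s => [|q s [IH1 IH2]].
  rewrite (_ : (fun _ => _) = fun=> 0); last by apply/funext => x; rewrite big_nil.
  by have [h1 ->] := C1_along_cst i 0; split => //; exact: hermspan0.
rewrite (_ : (fun _ => _) = fun x => q.1 * hermfun q.2 x + \sum_(q <- s) q.1 * hermfun q.2
  x); last first.
  by apply/funext => x; rewrite big_cons.
have [c1 c2] := C1_along_cst i q.1.
have [h1 h2] := C1_alongM c1 (@C1_hermfun R N i q.2).
have [h3 h4] := C1_alongD h1 IH1.
split; first exact: h3.
rewrite h4; apply: hermspanD => //; rewrite h2 c2 partial_hermfun.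
have := hermspanZ q.1 (hermspanD (hermspanZ ((q.2 i)%:R / 2) (hermspan_hermfun (dec q.2 i)))
  (hermspanZ (-1) (hermspan_hermfun (inc q.2 i)))).
by congr hermspan; apply/funext => x; rewrite mul0r addr0 mulN1r.
Qed.

Lemma hermspan_continuous f : hermspan f -> continuous f.
Proof.
move=> [s ->]; elim: s => [|q s IH].
  rewrite (_ : (fun _ => _) = fun=> 0); first exact: cst_continuous.
  by apply/funext => x; rewrite big_nil.
rewrite (_ : (fun _ => _) = fun x => q.1 * hermfun q.2 x + \sum_(q <- s) q.1 * hermfun q.2
  x); last first.
  by apply/funext => x; rewrite big_cons.
apply: continuous_addf => //; apply: continuous_mulf; first exact: cst_continuous.
exact: continuous_hermfun.
Qed.

Lemma hermspan_smooth f : hermspan f -> smooth f.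
Proof.
move=> hf s; have {}hf : hermspan (foldr (@partial R N) f s).
  by elim: s => //= i s IH; have [] := hermspan_partial i IH.
split; first exact: hermspan_continuous.
by move=> i x; have [[_ h _] _] := hermspan_partial i hf; exact: h.
Qed.

End SmoothHermiteSpan.

Section Sharpness.
Context {R : realType} {N : nat}.
Notation F := ('rV[R]_N -> R).
Notation idx := {ffun 'I_N -> nat}.
Notation hermfun := (@hermfun R N).
Notation idx0 := ([ffun=> 0%N] : idx).
Variables (i0 i1 i2 : 'I_N).
Hypotheses (n01 : i0 != i1) (n02 : i0 != i2) (n12 : i1 != i2).

Let al : idx := inc (inc idx0 i1) i2.
Let be : idx := inc (inc idx0 i0) i2.
Let c j : R := (i0 == j)%:R.
Let d j : R := - (i1 == j)%:R.

(* The rotation field of the (x_{i0}, x_{i1})-plane, multiplied by [x_{i2}] and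
   the Gaussian: an eigenfield at the second excited level. *)
Definition extremal (x : 'rV[R]_N) : 'rV[R]_N := \row_j (c j * hermfun al x + d j * hermfun
  be x).

Let compE j : ucomp extremal j = fun x => c j * hermfun al x + d j * hermfun be x.
Proof. by apply/funext => x; rewrite /ucomp mxE. Qed.

Let hermspan_extremal j : hermspan (ucomp extremal j).
Proof. by rewrite compE; apply: hermspanD; apply: hermspanZ; exact: hermspan_hermfun. Qed.

Let partialE i j : partial i (ucomp extremal j) =
  fun x => c j * partial i (hermfun al) x + d j * partial i (hermfun be) x.
Proof.
rewrite compE; have [c1 e1] := C1_along_cst i (c j); have [d1 f1] := C1_along_cst i (d j).
have [c2 e2] := C1_alongM c1 (@C1_hermfun R N i al);
  have [d2 f2] := C1_alongM d1 (@C1_hermfun R N i be).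
have [_ ->] := C1_alongD c2 d2; rewrite e2 f2 e1 f1.
by apply/funext => x; rewrite !mul0r !addr0.
Qed.

Let alE x : hermfun al x = x 0 i2 * (x 0 i1 * gaussian x).
Proof. by rewrite coord_hermfun1 eq_sym (negbTE n12) !mul0r addr0. Qed.

Let beE x : hermfun be x = x 0 i2 * (x 0 i0 * gaussian x).
Proof. by rewrite coord_hermfun1 eq_sym (negbTE n02) !mul0r addr0. Qed.

Lemma extremal_toroidal : toroidal extremal.
Proof.
split => x.
  rewrite (eq_bigr (fun j => (i0 == j)%:R * (hermfun al x * x 0 j) + (i1 == j)%:R * (-
    hermfun be x * x 0 j))).
    by rewrite big_split /= !sum_delta alE beE; ring.
  by move=> j _; rewrite mxE /c /d; ring.
rewrite /divergence.
rewrite (eq_bigr (fun j => (i0 == j)%:R * partial j (hermfun al) x + (i1 == j)%:R * (-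
  partial j (hermfun be) x))).
  (* As the three indices are distinct, neither derivative has a lowered term, and both are minus
     the Hermite function of e_{i0} + e_{i1} + e_{i2}. *)
  rewrite big_split /= !sum_delta !partial_hermfun /al /be !ffunE.
  rewrite [i0 == i1](negbTE n01) [i0 == i2](negbTE n02) eq_sym (negbTE n01) (negbTE n12)
    !addn0 !mul0r !sub0r.
  by rewrite (incC (inc idx0 i1)) (incC idx0) -(incC (inc idx0 i0)) subrr.
by move=> j _; rewrite -/(ucomp extremal j) partialE /c /d; ring.
Qed.

Lemma extremal_smooth_toroidal : smooth_toroidal extremal.
Proof.
split; [by move=> j; apply: hermspan_smooth; exact: hermspan_extremal|exact:
  extremal_toroidal|].
rewrite energyE ?ltry//; split.
- by move=> j; apply: L2_hermspan; exact: hermspan_extremal.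
- by move=> i j; apply: L2_hermspan; apply: hermspan_mulx; exact: hermspan_extremal.
- move=> i j; have -> : gcomp (grad extremal) i j = partial i (ucomp extremal j).
    by apply/funext => x; rewrite /gcomp mxE.
  by apply: L2_hermspan; have [] := hermspan_partial i (hermspan_extremal j).
Qed.

Let wE : weak_field extremal (grad extremal).
Proof. exact/smooth_weak_field/extremal_smooth_toroidal. Qed.

Let L a := @L2_hermfun R N a.
Let LZ (r : R) a := L2Z r (L a).
Let lu j : L2 (ucomp extremal j). Proof. by apply: L2_hermspan; exact: hermspan_extremal. Qed.

(** Lowering then raising restores a mode with coefficient a_i, and these add up to the degree 2.
    The images under d_i + x_i thus have total squared norm 4 times that of the field, from which
    the deficit subtracts 2. *)
Lemma extremal_deficit : deficit extremal (grad extremal) = (2 * unorm extremal)%:E.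
Proof.
rewrite (deficitE wE); congr EFin.
have := sum_ip_annihilated wE.
have gE i j : annihilated extremal (grad extremal) i j =
    fun x => c j * ((al i)%:R * hermfun (dec al i) x) + d j * ((be i)%:R * hermfun (dec be
      i) x).
  apply/funext => x; rewrite /annihilated /gcomp mxE -/(ucomp extremal j) partialE
    !partial_hermfun.
  have -> : xcomp extremal i j x = c j * (x 0 i * hermfun al x) + d j * (x 0 i * hermfun be x).
    by rewrite /xcomp mxE; ring.
  by rewrite !hermfun_mulx; field.
have dg (a : idx) i f : (a i)%:R * ip f (hermfun (inc (dec a i) i)) = (a i)%:R * ip f
  (hermfun a).
  by have [->|ai] := posnP (a i); rewrite ?mul0r// decK.
have h j : \sum_i ip (annihilated extremal (grad extremal) i j) (annihilated extremal (grad
  extremal) i j)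
    = 4 * ip (ucomp extremal j) (ucomp extremal j).
  rewrite (eq_bigr (fun i => (al i)%:R * (2 * (c j * ip (ucomp extremal j) (hermfun al)))
     + (be i)%:R * (2 * (d j * ip (ucomp extremal j) (hermfun be))))); last first.
    move=> i _; have la := L2_annihilated wE i j.
    rewrite {2}gE ipDr ?ipZr ?ip_annihilated//; try by do ? apply: L2Z; exact: L.
    transitivity (2 * c j * ((al i)%:R * ip (ucomp extremal j) (hermfun (inc (dec al i) i)))
      + 2 * d j * ((be i)%:R * ip (ucomp extremal j) (hermfun (inc (dec be i) i)))).
      by move: (c j) (d j) (al i) (be i) (ip _ _) (ip _ _) => *; ring.
    by rewrite !dg; move: (c j) (d j) (al i) (be i) (ip _ _) (ip _ _) => *; ring.
  rewrite big_split /= -!mulr_suml -!natr_sum -/(deg al) -/(deg be).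
  have deg0 : deg idx0 = 0%N by rewrite /deg big1// => k _; rewrite ffunE.
  have -> : deg al = 2%N by rewrite /al !deg_inc deg0.
  have -> : deg be = 2%N by rewrite /be !deg_inc deg0.
  have -> : ip (ucomp extremal j) (ucomp extremal j) =
      c j * ip (ucomp extremal j) (hermfun al) + d j * ip (ucomp extremal j) (hermfun be).
    by rewrite [X in ip _ X = _]compE ipDr// !ipZr.
  by move: (c j) (d j) (ip _ _) (ip _ _) => *; ring.
rewrite (eq_bigr _ (fun j _ => h j)) -mulr_sumr -/(unorm extremal) natrD => H; lra.
Qed.

(** A field of degree 2 is orthogonal to every linear field times the Gaussian, so subtracting one
    can only increase the norm. *)
Lemma extremal_dist_linear : ((unorm extremal)%:E <= dist_linear extremal)%E.
Proof.
apply: le_ereal_inf_tmp => _ [A _ <-].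
pose Q j x := \sum_i A j i * hermfun (inc idx0 i) x.
pose V x := extremal x - gaussian x *: linear_field A x.
have lQ j : L2 (Q j) by apply: L2_sum => i; exact: L2Z.
have VE j : ucomp V j = fun x => ucomp extremal j x - Q j x.
  by apply/funext => x; rewrite /Q -gaussian_linear_field /ucomp /V [LHS]mxE [X in _ + X =
    _]mxE.
rewrite (integralN_sqnorm_row (U := V)); last by move=> j; rewrite VE; exact: L2B.
rewrite lee_fin; apply: ler_sum => j _; rewrite VE ip_sqrB//.
have -> : ip (ucomp extremal j) (Q j) = 0.
  rewrite /Q ip_sumr//; apply: big1 => i _; rewrite ipZr// ipC compE.
  by rewrite ipDr// !ipZr// !ip_hermfun12 !mulr0 addr0 mulr0.
by rewrite mulr0 subr0 lerDl ip_ge0.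
Qed.

Lemma extremal_unorm_gt0 : 0 < unorm extremal.
Proof.
rewrite /unorm (bigD1 i0)//= ltr_wpDr ?sumr_ge0// => [j _|]; first exact: ip_ge0.
have -> : ucomp extremal i0 = hermfun al.
  by rewrite compE; apply/funext => x; rewrite /c /d eqxx eq_sym (negbTE n01) /=; ring.
by rewrite ip_hermfun eqxx mul1r hnorm_gt0.
Qed.

(** Dropping the quadratic distance, which is nonnegative, leaves C |U|^2 <= 2 |U|^2 for a nonzero
    field U. *)
Lemma extremal_sharp (C : R) :
  (C%:E * dist_linear extremal + 2%:E * dist_quadratic extremal
     <= deficit extremal (grad extremal))%E -> C <= 2.
Proof.
move=> h; rewrite leNgt; apply/negP => C2.
have C0 : 0 <= C by lra.
have q0 : (0 <= dist_quadratic extremal)%E.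
  apply: le_ereal_inf_tmp => _ [A _ [B _ <-]].
  by apply: integralN_ge0 => x; exact: sqnorm_mx_ge0.
have : ((C * unorm extremal)%:E <= (2 * unorm extremal)%:E)%E.
  rewrite -extremal_deficit; apply: le_trans h.
  rewrite EFinM -[X in (X <= _)%E]adde0; apply: leeD; last by rewrite mule_ge0.
  by apply: lee_wpmul2l; [rewrite lee_fin|exact: extremal_dist_linear].
by rewrite lee_fin ler_pM2r ?extremal_unorm_gt0// leNgt C2.
Qed.

End Sharpness.

Unset Implicit Arguments.

Theorem theorem1p6 (R : realType) (N : nat) (N_ge3 : (3 <= N)%N) :
  (forall (U : 'rV[R]_N -> 'rV[R]_N) (G : 'rV[R]_N -> 'M[R]_N),
     toroidal_field U G ->
     (2%:E * dist_linear U + 2%:E * dist_quadratic U <= deficit U G)%E) /\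
  (forall C : R,
     (forall (U : 'rV[R]_N -> 'rV[R]_N) (G : 'rV[R]_N -> 'M[R]_N),
        toroidal_field U G ->
        (C%:E * dist_linear U + 2%:E * dist_quadratic U <= deficit U G)%E) ->
     C <= 2).
Proof.
split=> [U G [[sU ->]|cU]|C hC].
- exact/weak_field_stability/smooth_weak_field.
- exact/weak_field_stability/completion_weak_field.
pose i0 := Ordinal (ltn_trans (ltn0Sn 1) N_ge3).
pose i1 := Ordinal (ltn_trans (ltnSn 1) N_ge3).
pose i2 := Ordinal N_ge3.
apply: (@extremal_sharp R N i0 i1 i2) => //.
apply: hC; left; split => //.
exact: extremal_smooth_toroidal.
Qed.
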